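(* Assume $\pi/2\le\bar\theta<\pi$. Let $\Pi_1$ be the orthogonal projection of $\mathbb{R}^2$ onto the line $\{x_1=0\}$. As $k\to\infty$, the solutions $u_k$ of the penalized problem converge uniformly on compact subsets of $\mathbb{R}^+=[0,\infty)$ to the function $u_\infty$ given by $$u_\infty(t)=\begin{cases} u(0)+t\,\Pi_1\dot u(0) & \text{if } 0\le t\le t_0,\\ 0 & \text{if } t_0\le t,\end{cases}$$ where $u(0)=(0,x_2(0))^T$, $\dot u(0)=(\dot x_1(0),\dot x_2(0))^T$ and $t_0=-x_2(0)/\dot x_2(0)$.
   Context: Fix $\bar\theta\in(0,\pi)$ and let $K=\{(x_1,x_2)\in\mathbb{R}^2: x_1\le 0 \text{ and } x_1\cos\bar\theta+x_2\sin\bar\theta\le 0\}$, a closed convex cone; $P_K$ is the projection onto $K$ (nearest point map). For $u,v\in\mathbb{R}^2$ put $$G(u,v)=\frac{\bigl(v\cdot(u-P_Ku)\bigr)(u-P_Ku)}{|u-P_Ku|^2}\ \text{ if } u\notin K,\qquad G(u,v)=0\ \text{ if } u\in K.$$ Fix $\alpha>1$ and real numbers $x_2(0)<0$, $\dot x_1(0)>0$, $\dot x_2(0)>0$, all independent of $k$. For $k>0$, $u_k:[0,\infty)\to\mathbb{R}^2$ is the ($C^1$) solution of the penalized problem $$\ddot u_k+2\alpha\sqrt k\,G(u_k,\dot u_k)+k(u_k-P_Ku_k)=0\quad (t>0),$$ $$u_k(0)=(0,x_2(0))^T,\qquad \dot u_k(0)=(\dot x_1(0),\dot x_2(0))^T.$$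 *)

(* Defs.v *)
From HB Require Import structures.
From mathcomp Require Import all_boot all_order all_algebra.
From mathcomp Require Import all_classical all_reals all_analysis.
Set Implicit Arguments.
Unset Strict Implicit.
Unset Printing Implicit Defensive.
Import Order.TTheory GRing.Theory Num.Theory.
Import numFieldNormedType.Exports.
Local Open Scope classical_set_scope.
Local Open Scope ring_scope.

(* The plane is 'rV[R]_2; the coordinates x_1, x_2 of the
   mathematical text are [x 0 0] and [x 0 1].  The library norm [`|x|] on
   'rV[R]_2 is the sup norm: it is used below only where any equivalent norm
   gives the same notion (limits, derivatives, absolute continuity); the
   Euclidean geometry is expressed with [dotp] and [enorm]. *)

Section Plane.
Context {R : realType}.
Implicit Types (x y u v p : 'rV[R]_2) (A L : set 'rV[R]_2).

Definition pt (a b : R) : 'rV[R]_2 := \row_(i < 2) (if i == 0 then a else b).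

Definition dotp x y : R := \sum_(i < 2) x 0 i * y 0 i.

Definition enorm x : R := Num.sqrt (dotp x x).

Definition is_nearest_point A u p : Prop :=
  A p /\ forall q, A q -> enorm (u - p) <= enorm (u - q).

(* The default value 0 of [xget] is irrelevant when A is a nonempty closed
   convex set, since the nearest point then exists and is unique. *)
Definition nearest_proj A u : 'rV[R]_2 := xget 0 (is_nearest_point A u).

Definition orth_proj L u : 'rV[R]_2 :=
  xget 0 [set p | L p /\ forall q, L q -> dotp (u - p) q = 0].

Definition coneK (theta : R) : set 'rV[R]_2 :=
  [set x | x 0 0 <= 0 /\ x 0 0 * cos theta + x 0 1 * sin theta <= 0].

Definition dampG A u v : 'rV[R]_2 :=
  if u \in A then 0 else
  let w := u - nearest_proj A u in (dotp v w / enorm w ^+ 2) *: w.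

End Plane.

Section HalfLine.
Context {R : realType} {V : normedModType R}.
Implicit Types (f u v : R -> V).

(* The finite family of intervals is a list of pairs of end points; degenerate
   intervals are harmless. *)
Definition abs_continuous (a b : R) f : Prop :=
  forall e : R, 0 < e -> exists2 d : R, 0 < d &
    forall s : seq (R * R),
      all (fun I => [&& a <= I.1, I.1 <= I.2 & I.2 <= b]) s ->
      pairwise (fun I J => (I.2 <= J.1) || (J.2 <= I.1)) s ->
      \sum_(I <- s) (I.2 - I.1) < d ->
      \sum_(I <- s) `|f I.2 - f I.1| < e.

(* u is C^1 on [0, +oo[ with derivative v (one-sided derivative at 0).
   The values of u and v on ]-oo, 0[ play no role. *)
Definition C1_halfline u v : Prop :=
  [/\ forall t : R, 0 < t -> is_derive t 1 u (v t),
      h^-1 *: (u h - u 0) @[h --> 0^'+] --> v 0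
    & {within `[0, +oo[, continuous v}].

End HalfLine.

Section Penalized.
Context {R : realType}.

(* dampG is discontinuous across the boundary of coneK, so a C^1 solution need not be
   twice differentiable at the instants where it crosses that boundary: the
   equation is understood in the sense of Caratheodory (the velocity v is
   locally absolutely continuous and satisfies the equation almost
   everywhere).  Classical solutions are included. *)
Definition penalized_solution (theta alpha k : R) (u0 v0 : 'rV[R]_2)
    (u : R -> 'rV[R]_2) : Prop :=
  exists v : R -> 'rV[R]_2,
  [/\ C1_halfline u v,
      u 0 = u0 /\ v 0 = v0,
      forall T, 0 < T -> abs_continuous 0 T v
    & {ae @lebesgue_measure R, forall t : R, 0 < t ->
        derivable v t 1 /\
        'D_1 v t + (2 * alpha * Num.sqrt k) *: dampG (coneK theta) (u t) (v t)
          + k *: (u t - nearest_proj (coneK theta) (u t)) = 0}].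

Definition u_infty (u0 v0 : 'rV[R]_2) (t0 t : R) : 'rV[R]_2 :=
  if t <= t0 then u0 + t *: orth_proj [set x | x 0 0 = 0] v0 else 0.

End Penalized.

(* Main.v *)
Require Import Defs.
From HB Require Import structures.
From mathcomp Require Import all_boot all_order all_algebra.
From mathcomp Require Import all_classical all_reals all_analysis.
From mathcomp Require Import measurable_realfun.
From mathcomp Require Import ring lra.
Import Order.TTheory GRing.Theory Num.Theory.
Import numFieldNormedType.Exports.
Local Open Scope classical_set_scope.
Local Open Scope ring_scope.

(** The proof follows one solution through the regions of the complement of K
    and reduces everything to a decay estimate for its energy.  Write
    n = (cos theta, sin theta) for the outer normal of the second face,
    m = (- sin theta, cos theta) for the unit vector along it, kappa for
    the square root of k, and u = (x1, x2).  The projection onto K has three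
    simple forms outside K: near the face x1 = 0 (x1 > 0, x2 < 0) it is
    (0, x2); in the polar cone (x2 > 0, u.m < 0) it is 0; near the second
    face (u.m > 0, u.n > 0) it is u - (u.n) n.  In each of these open
    regions the equation has continuous coefficients, so an absolutely
    continuous velocity that satisfies it almost everywhere is of class C^1
    there ([abs_continuous_is_derive]), and ordinary calculus applies.

    Up to the time t0 = - x2(0) / x2'(0), the point slides along the first
    face: x2 is affine and x1 is an overdamped oscillator with x1(0) = 0.
    Since alpha > 1, x1' + alpha kappa x1 stays positive, hence x1 > 0 until
    t0; moreover kappa x1(t0) = O(kappa^(-1/2)) ([face1_phase]).

    At t0 the point enters the polar cone with velocity of order one, and
    this velocity has to be lost within a time that tends to 0.  The force is
    central there, so the angular momentum keeps its small value
    x1(t0) x2'(0), and the tangential speed, which is the angular momentum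
    divided by |u|, is small as soon as |u| is not too small.  A short
    ballistic stretch of length tau, with (kappa tau)^2 comparable to
    kappa x1(t0), takes |u| to the order of x2'(0) tau while the forces have
    no time to push x1 below 0 ([polar_entry]); this is where the hypothesis
    pi / 2 <= theta is used, since then the whole open first quadrant lies in
    the polar cone.  Afterwards |u|' >= - alpha kappa |u| keeps |u| from
    decaying too fast, and positive angular momentum lets the point leave the
    polar cone only through the second face, where it remains with constant
    tangential speed ([polar_exit]).

    With small tangential speed, what remains is an overdamped oscillator for
    the distance to K.  The energy N = |v|^2 + kappa^2 dist(u, K)^2,
    with v the velocity, never increases, and a virial identity bounds its
    time integral by O(1 / kappa) up to the tangential contribution.  Hence
    after a further time S / kappa one has
    N <= O(1 / S) + O(kappa x1(t0)) e^(2 alpha S) ([motion_settles]).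
    Choosing S large and then kappa large makes the speed as small as desired
    for all later times, so the point stays near the apex on any given
    bounded time interval ([motion_converges]). *)

Set Implicit Arguments.
Unset Strict Implicit.
Unset Printing Implicit Defensive.

(** * Absolutely continuous functions and almost-everywhere derivatives *)

(** Continuous induction on a segment: a property that can be carried across a
    neighbourhood of every point propagates from the left end to the right end.
    It replaces the choice of a finite cover adapted to a gauge. *)
Lemma real_induction (R : realType) (P : R -> Prop) (a b : R) : a <= b -> P a ->
  (forall z, a <= z <= b -> exists2 d, 0 < d & forall x y,
     a <= x <= z -> z <= y <= b -> z - d < x -> y < z + d -> P x -> P y) ->
  P b.
Proof.
move=> ab Pa step.
pose S := [set x | a <= x <= b /\ P x].
have Sa : S a by rewrite /S /= lexx ab.
have Sub : has_ubound S by exists b => x [/andP[_ ->]].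
have supS : has_sup S by split; [exists a|].
have az : a <= sup S by exact: ub_le_sup.
have zb : sup S <= b by apply: ge_sup; [exists a|move=> x [/andP[]]].
have [d d0 H] := step (sup S) (introT andP (conj az zb)).
have [x [/andP[ax xb] Px] zdx] := sup_adherent d0 supS.
have xz : x <= sup S by apply: ub_le_sup => //; split=> //; rewrite ax xb.
pose y := Num.min b (sup S + d / 2).
have zy : sup S <= y <= b.
  by rewrite /y le_min ge_min lexx zb lerDl /= ltW ?divr_gt0.
have Py : P y.
  apply: (H x y) => //; first by rewrite ax xz.
  rewrite /y gt_min; apply/orP; right; rewrite ltrD2l; lra.
have yS : y <= sup S.
  apply: ub_le_sup => //; split=> //.
  by case/andP: zy => z1 ->; rewrite (le_trans az).
have by_ : y = b.
  move: yS; rewrite /y ge_min => /orP[|] h; last by exfalso; lra.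
  by rewrite min_l //; lra.
by rewrite -by_.
Qed.

Lemma first_nonpos (R : realType) (g : R -> R) (a t : R) : continuous g ->
  0 < g a -> a <= t -> g t <= 0 ->
  exists c, [/\ a < c, c <= t, g c = 0 & forall s, a <= s < c -> 0 < g s].
Proof.
move=> gc ga at_ gt.
pose S := [set x | a <= x /\ g x <= 0].
have St : S t by [].
have Slb : has_lbound S by exists a => x [].
have infS : has_inf S by split; [exists t|].
have ac : a <= inf S by apply: lb_le_inf; [exists t|move=> x []].
have ct : inf S <= t by exact: ge_inf.
have below s : a <= s < inf S -> 0 < g s.
  move=> /andP[as_ sc]; rewrite ltNge; apply/negP => gs.
  by move: sc; rewrite ltNge => /negP; apply; exact: ge_inf.
have gc0 : g (inf S) <= 0.
  rewrite leNgt; apply/negP => gp.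
  have /cvgrPdist_lt /(_ _ gp) := gc (inf S).
  rewrite near_simpl => /nbhs_ballP[d /= d0 hd].
  have [x [ax gx] xd] := inf_adherent d0 infS.
  have ix : inf S <= x by exact: ge_inf.
  have := hd x; rewrite /ball /= => /(_ _).
  rewrite distrC ger0_norm ?subr_ge0 // ltrBlDl => /(_ xd).
  by rewrite ltr_norml => /andP[_]; lra.
have ac' : a < inf S.
  by rewrite lt_neqAle ac andbT; apply/eqP => aE; move: ga; rewrite aE; lra.
exists (inf S); split=> //; apply/eqP; rewrite eq_le gc0 /= leNgt; apply/negP => gn.
have ngn : 0 < - g (inf S) by lra.
have /cvgrPdist_lt /(_ _ ngn) := gc (inf S).
rewrite near_simpl => /nbhs_ballP[d /= d0 hd].
pose s := Num.max a (inf S - d / 2).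
have sc : a <= s < inf S by rewrite /s le_max lexx gt_max ac' /=; lra.
have := hd s; rewrite /ball /= => /(_ _).
have := below s sc.
case/andP: sc => _ sc; rewrite ger0_norm ?subr_ge0 ?ltW // => gs /(_ _).
have hs : inf S - d / 2 <= s by rewrite /s le_max lexx orbT.
have hh : inf S - s < d by lra.
by move=> /(_ hh); rewrite ltr_norml => /andP[]; lra.
Qed.

(** A strict inequality that can be recovered at each time from its validity at
    all earlier times holds throughout. *)
Lemma continuous_bootstrap (R : realType) (g : R -> R) (a b : R) : continuous g ->
  0 < g a ->
  (forall c, a < c -> c <= b -> (forall s, a <= s < c -> 0 < g s) -> 0 < g c) ->
  forall t, a <= t <= b -> 0 < g t.
Proof.
move=> gc ga H t /andP[at_ tb]; rewrite ltNge; apply/negP => gt.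
have [c [ac ct gc0 below]] := first_nonpos gc ga at_ gt.
by have := H c ac (le_trans ct tb) below; rewrite gc0 ltxx.
Qed.

Lemma derive_lower_bound_near (R : realType) (f : R -> R) (z c e : R) :
  derivable f z 1 -> c <= 'D_1 f z -> 0 < e ->
  exists2 d, 0 < d & forall y, `|y - z| < d ->
    (z <= y -> (c - e) * (y - z) <= f y - f z) /\
    (y <= z -> (c - e) * (z - y) <= f z - f y).
Proof.
move=> df Df e0.
have /cvgrPdist_lt /(_ _ e0) : h^-1 *: (f (h *: 1 + z) - f z) @[h --> 0^'] --> 'D_1 f z.
  exact: df.
move=> /nbhs_ballP[d /= d0 hd].
exists d => // y yz.
have [->|yz0] := eqVneq y z; first by rewrite !subrr !mulr0.
have yz1 : y - z != 0 by rewrite subr_eq0.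
have := hd (y - z); rewrite /ball /= sub0r normrN => /(_ yz yz1).
rewrite /GRing.scale /= mulr1 subrK ltr_norml => /andP[h1 h2].
have {h2} : c - e < (y - z)^-1 * (f y - f z) by lra.
move=> h2; split=> [zy|zy].
- have p : 0 < y - z by rewrite lt_neqAle eq_sym yz1 subr_ge0.
  by rewrite ltW // -ltr_pdivlMr // mulrC.
- have p : 0 < z - y by rewrite lt_neqAle eq_sym subr_eq0 eq_sym yz0 subr_ge0.
  rewrite ltW // -ltr_pdivlMr // mulrC.
  by rewrite -(opprB y z) invrN mulNr -mulrN opprB.
Qed.

(** The exceptional null set, together with the two end points, lies in an open
    set U of small measure.  A point of U is crossed by adding a small interval
    of U to a list, any other point by the lower bound on its derivative; the
    list has total length at most the measure of U, so absolute continuity makes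
    its contribution to the increment of f negligible. *)
Lemma abs_continuous_ae_derive_ge (R : realType) (f : R -> R) (a b c : R) :
  a <= b -> abs_continuous a b f ->
  {ae @lebesgue_measure R, forall t : R, a < t < b ->
     derivable f t 1 /\ c <= 'D_1 f t} ->
  c * (b - a) <= f b - f a.
Proof.
move=> ab acf [A [mA A0 sA]].
apply/ler_addgt0Pl => e0 e0p.
pose e := e0 / (b - a + 2).
have ba1 : 0 < b - a + 2 by lra.
have ep : 0 < e by rewrite divr_gt0.
have [d1 d1p acd] := acf e ep.
have c1 : 0 < `|c| + 1 by rewrite ltr_wpDl.
pose d := Num.min d1 (e / (`|c| + 1)).
have dp : 0 < d by rewrite lt_min d1p divr_gt0.
pose mu := @lebesgue_measure R.
pose A' := A `|` [set a; b].
have mA' : measurable A'.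
  by apply: measurableU => //; apply: measurableU; exact: measurable_set1.
have A'0 : mu A' = 0%E.
  apply/eqP; rewrite -measure_le0.
  apply: (le_trans (measureU2 _ _ _)) => //; first exact: measurableU.
  rewrite [X in (X + _ <= _)%E]A0 add0e; apply: (le_trans (measureU2 _ _ _)) => //.
  rewrite [X in (X + _ <= _)%E]lebesgue_measure_set1.
  by rewrite [X in (_ + X <= _)%E]lebesgue_measure_set1 adde0.
have [||U [oU A'U mU]] := @lebesgue_regularity_outer R A' d mA' => //.
  by rewrite [X in (X < _)%E]A'0 ltry.
have mUm : measurable U by exact: open_measurable.
have muU : (mu U < d%:E)%E.
  apply: le_lt_trans mU.
  rewrite -[X in (mu X <= _)%E](setDUK A'U).
  apply: (le_trans (measureU2 _ _ _)) => //; first exact: measurableD.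
  by rewrite [X in (X + _ <= _)%E]A'0 add0e.
pose good (x : R) (s : seq (R * R)) :=
  [/\ all (fun I : R * R => [&& a <= I.1, I.1 <= I.2 & I.2 <= x]) s,
      pairwise (fun I J : R * R => (I.2 <= J.1) || (J.2 <= I.1)) s,
      ((\sum_(I <- s) (I.2 - I.1))%:E <= mu (U `&` `[a, x]))%E
    & (c - e) * (x - a) -
      \sum_(I <- s) (`|f I.2 - f I.1| + `|c| * (I.2 - I.1)) <= f x - f a].
have [s [s1 s2 s3 s4]] : exists s, good b s.
  apply: (@real_induction _ (fun x => exists s, good x s) a b) => //.
    by exists [::]; split; rewrite ?big_nil ?subrr ?mulr0 ?subr0 //.
  move=> z /andP[az zb].
  have widen x y s : x <= y -> good x s ->
      [/\ all (fun I : R * R => [&& a <= I.1, I.1 <= I.2 & I.2 <= y]) s,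
      pairwise (fun I J : R * R => (I.2 <= J.1) || (J.2 <= I.1)) s &
      ((\sum_(I <- s) (I.2 - I.1))%:E <= mu (U `&` `[a, y]))%E].
    move=> xy [g1 g2 g3 _]; split=> //.
      by apply: sub_all g1 => I /and3P[-> -> /=] /le_trans; apply.
    apply: (le_trans g3); apply: le_measure; rewrite ?inE; try exact: measurableI.
    apply: setIS => t /=; rewrite !in_itv /= => /andP[-> /=] /le_trans; exact.
  (* A point of U is stepped over at the cost of one more interval. *)
  have [zU|zU] := pselect (U z).
    have /nbhs_ballP[dd /= dd0 hdd] : nbhs z U by exact: open_nbhs_nbhs.
    exists dd => // x y /andP[ax xz] /andP[zy yb] zx yz [s gs].
    have xy : x <= y by exact: le_trans zy.
    have [g1 g2 g3 g4] := gs.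
    exists ((x, y) :: s); split.
    - rewrite /= ax xy lexx /=.
      by apply: sub_all g1 => I /and3P[-> -> /=] /le_trans; apply.
    - rewrite /= g2 andbT; apply: sub_all g1 => I /and3P[_ _ /= ->].
      by rewrite orbT.
    - rewrite big_cons /=.
      have -> : U `&` `[a, y] = (U `&` `[a, x]) `|` `]x, y].
        apply/seteqP; split=> t /=; rewrite !in_itv /=.
          move=> [Ut /andP[at_ ty]].
          by case: (leP t x) => tx; [left; rewrite at_|right].
        move=> [[Ut /andP[at_ tx]]|/andP[xt ty]].
          by rewrite at_ (le_trans tx).
        split; last by rewrite ty (le_trans ax (ltW xt)).
        apply: hdd; rewrite /ball /= ltr_norml; lra.
      rewrite [X in (_ <= X)%E](@measureU _ _ _ (@lebesgue_measure R)) //; first last.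
      + apply/seteqP; split=> // t /=; rewrite !in_itv /=.
        by move=> [[_ /andP[_ tx]] /andP[xt _]]; move: tx; rewrite leNgt xt.
      + exact: measurableI.
      rewrite EFinD addeC leeD //.
      move: xy; rewrite le_eqVlt => /predU1P[->|xy].
        by rewrite subrr measure_ge0.
      by rewrite [X in (_ <= X)%E](lebesgue_measure_itv `]x, y]) /= lte_fin xy EFinB.
    - rewrite big_cons /=.
      have n1 : - (f y - f x) <= `|f y - f x| by rewrite -normrN ler_norm.
      have n2 : c <= `|c| by exact: ler_norm.
      nra.
  have [dfz Dfz] : derivable f z 1 /\ c <= 'D_1 f z.
    have zA : ~ A' z by move=> /A'U.
    have zab : a < z < b.
      rewrite !lt_neqAle az zb !andbT; apply/andP; split; apply/eqP => h; apply: zA; right.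
        by left.
      by right.
    apply: contrapT => h; apply: zA; left; apply: sA => /= /(_ zab); exact: h.
  have [dd dd0 hdd] := derive_lower_bound_near dfz Dfz ep.
  exists dd => // x y /andP[ax xz] /andP[zy yb] zx yz [s gs].
  have xy : x <= y by exact: le_trans zy.
  exists s; have [w1 w2 w3] := widen x y s xy gs; split=> //.
  have [_ _ _ g4] := gs.
  have [_ /(_ xz) h1] := hdd x
    ltac:(by rewrite distrC ger0_norm ?subr_ge0 // ltrBlDr -ltrBlDl).
  have [/(_ zy) h2 _] := hdd y ltac:(by rewrite ger0_norm ?subr_ge0 // ltrBlDl).
  nra.
have sd : \sum_(I <- s) (I.2 - I.1) < d.
  rewrite -lte_fin; apply: le_lt_trans s3 _; apply: le_lt_trans muU.
  apply: le_measure; rewrite ?inE //; first exact: measurableI.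
have [sd1 sd2] : \sum_(I <- s) (I.2 - I.1) < d1 /\
    `|c| * \sum_(I <- s) (I.2 - I.1) <= e.
  have S0 : 0 <= \sum_(I <- s) (I.2 - I.1).
    rewrite big_seq; apply: sumr_ge0 => I /(allP s1) /and3P[_ h _].
    by rewrite subr_ge0.
  move: sd; rewrite lt_min => /andP[-> ]; rewrite ltr_pdivlMr // => h.
  by split=> //; nra.
have := acd s s1 s2 sd1.
rewrite big_split /= -mulr_sumr in s4.
have -> : e0 = e * (b - a + 2) by rewrite /e divfK ?gt_eqF.
nra.
Qed.

Lemma ae_lebesgueS (R : realType) (P Q : R -> Prop) :
  (forall t, P t -> Q t) -> {ae @lebesgue_measure R, forall t, P t} ->
  {ae @lebesgue_measure R, forall t, Q t}.
Proof.
move=> PQ [A [mA A0 sA]]; exists A; split=> // t nQ; apply: sA => Pt.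
exact/nQ/PQ.
Qed.

Lemma abs_continuousW (R : realType) (f : R -> R) (a b a' b' : R) :
  a <= a' -> b' <= b -> abs_continuous a b f -> abs_continuous a' b' f.
Proof.
move=> aa bb acf e /acf[d d0 H]; exists d => // s s1; apply: H.
apply: sub_all s1 => I /and3P[i1 i2 i3].
by rewrite (le_trans aa i1) i2 (le_trans i3 bb).
Qed.

Lemma abs_continuousN (R : realType) (f : R -> R) (a b : R) :
  abs_continuous a b f -> abs_continuous a b (fun t => - f t).
Proof.
move=> acf e /acf[d d0 H]; exists d => // s s1 s2 s3.
rewrite (eq_bigr (fun I : R * R => `|f I.2 - f I.1|)); first exact: H.
by move=> I _; rewrite -normrN; congr (`|_|); ring.
Qed.

Lemma is_derive_of_bound (R : realType) (f : R -> R) (t l : R) :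
  (forall e, 0 < e -> exists2 d, 0 < d & forall y, `|y - t| < d ->
     `|f y - f t - l * (y - t)| <= e * `|y - t|) ->
  is_derive t 1 f l.
Proof.
move=> H.
have cv : h^-1 *: (f (h *: 1 + t) - f t) @[h --> 0^'] --> l.
  apply/cvgrPdist_le => e /H[d d0 hd].
  near=> h.
  have h0 : h != 0 by near: h; exact: nbhs_dnbhs_neq.
  have hs : `|h| < d by near: h; exact: dnbhs0_lt.
  have := hd (h + t); rewrite addrK => /(_ hs).
  rewrite /GRing.scale /= mulr1 => hh.
  rewrite -(ler_pM2r (_ : 0 < `|h|)) ?normr_gt0 // -normrM mulrBl.
  rewrite mulrAC mulVf // mul1r distrC; exact: hh.
apply: DeriveDef; first by apply/cvg_ex; exists l.
exact: cvg_lim cv.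
Unshelve. all: by end_near. Qed.

(** A Caratheodory solution is a classical one wherever the right-hand side is
    continuous: near t the almost-everywhere derivative is within e of F t, so
    the increments of f are within e of those of the linear function of slope
    F t. *)
Lemma abs_continuous_is_derive (R : realType) (f F G : R -> R) (t : R) :
  0 < t -> (forall T, 0 < T -> abs_continuous 0 T f) ->
  {ae @lebesgue_measure R, forall s : R, 0 < s ->
     derivable f s 1 /\ 'D_1 f s = G s} ->
  (\forall s \near t, G s = F s) -> {for t, continuous F} ->
  is_derive t 1 f (F t).
Proof.
move=> t0 acf aeG GF Fc; apply: is_derive_of_bound => e e0.
move/cvgrPdist_lt : Fc => /(_ _ e0).
rewrite near_simpl => Fe.
have [d /= d0 hd] : exists2 d, 0 < d & forall s, `|s - t| < d ->
    [/\ 0 < s, G s = F s & `|F t - F s| < e].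
  have P : \forall s \near t, [/\ 0 < s, G s = F s & `|F t - F s| < e].
    near=> s; split; near: s => //; exact: lt_nbhsr.
  move/nbhs_ballP : P => [d /= d0 hd]; exists d => // s sd.
  by apply: hd; rewrite /ball /= distrC.
exists d => // y yd.
have key a b : a <= b -> (forall s, a < s < b -> `|s - t| < d) -> 0 <= a -> 0 < b ->
    (F t - e) * (b - a) <= f b - f a <= (F t + e) * (b - a).
  move=> ab sub a0 b0; apply/andP; split.
    apply: abs_continuous_ae_derive_ge => //.
      exact: abs_continuousW (acf b b0).
    apply: ae_lebesgueS aeG => s H sab.
    have [s0 GFs /ltr_normlP[_ h]] := hd s (sub s sab).
    have [dfs ->] := H s0; split=> //; rewrite GFs; lra.
  have : (- F t - e) * (b - a) <= - f b - - f a.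
    apply: (@abs_continuous_ae_derive_ge _ (fun t => - f t)) => //.
      by apply: abs_continuousN; exact: abs_continuousW (acf b b0).
    apply: ae_lebesgueS aeG => s H sab.
    have [s0 GFs /ltr_normlP[h _]] := hd s (sub s sab).
    have [dfs dE] := H s0; split; first exact: derivableN.
    have -> : 'D_1 (fun t => - f t) s = - 'D_1 f s by exact: deriveN.
    rewrite dE GFs; lra.
  lra.
have [y0 _ _] := hd y yd.
case: (leP t y) => ty.
  have yt0 : 0 <= y - t by rewrite subr_ge0.
  rewrite [X in e * X]ger0_norm //.
  move: yd; rewrite ger0_norm // => yd.
  have /andP[h1 h2] := key t y ty
    ltac:(by move=> s /andP[s1 s2]; rewrite ger0_norm; lra) (ltW t0) y0.
  rewrite ler_norml; apply/andP; split; lra.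
have yt0 : y - t <= 0 by rewrite subr_le0 ltW.
rewrite [X in e * X]ler0_norm //.
move: yd; rewrite ler0_norm // => yd.
have /andP[h1 h2] := key y t (ltW ty)
  ltac:(by move=> s /andP[s1 s2]; rewrite ler0_norm; lra) (ltW y0) t0.
rewrite ler_norml; apply/andP; split; lra.
Unshelve. all: by end_near. Qed.

(** * Monotonicity and bootstrap arguments *)

(** Being a class, [is_derive] is otherwise solved by instance resolution, with
    an uncontrolled form of the value; the lemmas below are stated for functions
    written pointwise and are applied by a syntax-directed tactic. *)
Lemma der_eq (R : realType) (f : R -> R) (t a b : R) :
  is_derive t 1 f a -> a = b -> is_derive t 1 f b.
Proof. by move=> ? <-. Qed.

Lemma der_add (R : realType) (f g : R -> R) (t a b : R) :
  is_derive t 1 f a -> is_derive t 1 g b ->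
  is_derive t 1 (fun t => f t + g t) (a + b).
Proof. exact: is_deriveD. Qed.

Lemma der_opp (R : realType) (f : R -> R) (t a : R) :
  is_derive t 1 f a -> is_derive t 1 (fun t => - f t) (- a).
Proof. exact: is_deriveN. Qed.

Lemma der_mul (R : realType) (f g : R -> R) (t a b : R) :
  is_derive t 1 f a -> is_derive t 1 g b ->
  is_derive t 1 (fun t => f t * g t) (f t * b + g t * a).
Proof. exact: is_deriveM. Qed.

Lemma der_sqr (R : realType) (f : R -> R) (t a : R) :
  is_derive t 1 f a -> is_derive t 1 (fun t => f t ^+ 2) (2 * f t * a).
Proof.
move=> df; rewrite (_ : 2 * f t * a = f t * a + f t * a); last by ring.
exact: (der_mul df df).
Qed.

Lemma der_cst (R : realType) (c t : R) : is_derive t 1 (fun=> c) 0.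
Proof. exact: is_derive_cst. Qed.

Lemma der_id (R : realType) (t : R) : is_derive t 1 (fun t => t) 1.
Proof. exact: is_derive_id. Qed.

Lemma der_expR (R : realType) (f : R -> R) (t a : R) :
  is_derive t 1 f a -> is_derive t 1 (fun t => expR (f t)) (expR (f t) * a).
Proof. by move=> df; exact: is_derive1_comp. Qed.

Ltac deriv :=
  cbv beta;
  lazymatch goal with
  | |- is_derive _ _ (fun _ => ?c) _ => eapply der_cst
  | |- is_derive _ _ (fun x => x) _ => eapply der_id
  | |- is_derive _ _ (fun x => GRing.add (@?f x) (@?g x)) _ =>
      eapply (@der_add _ f g); deriv
  | |- is_derive _ _ (fun x => GRing.opp (@?f x)) _ =>
      eapply (@der_opp _ f); deriv
  | |- is_derive _ _ (fun x => GRing.mul (@?f x) (@?g x)) _ =>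
      eapply (@der_mul _ f g); deriv
  | |- is_derive _ _ (fun x => GRing.exp (@?f x) 2) _ =>
      eapply (@der_sqr _ f); deriv
  | |- is_derive _ _ (fun x => expR (@?f x)) _ =>
      eapply (@der_expR _ f); deriv
  | |- _ => eassumption
  end.

Lemma cont_add (R : realType) (f g : R -> R) :
  continuous f -> continuous g -> continuous (fun t => f t + g t).
Proof. by move=> cf cg x; exact: (continuousD (cf x) (cg x)). Qed.

Lemma cont_opp (R : realType) (f : R -> R) :
  continuous f -> continuous (fun t => - f t).
Proof. by move=> cf x; exact: (continuousN (cf x)). Qed.

Lemma cont_mul (R : realType) (f g : R -> R) :
  continuous f -> continuous g -> continuous (fun t => f t * g t).
Proof. by move=> cf cg x; exact: (continuousM (cf x) (cg x)). Qed.

Lemma cont_sqr (R : realType) (f : R -> R) :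
  continuous f -> continuous (fun t => f t ^+ 2).
Proof. by move=> cf; apply: cont_mul. Qed.

Lemma cont_expR (R : realType) (f : R -> R) :
  continuous f -> continuous (fun t => expR (f t)).
Proof.
by move=> cf x; apply: continuous_comp; [exact: cf|exact: continuous_expR].
Qed.

Lemma cont_cst (R : realType) (c : R) : continuous (fun _ : R => c).
Proof. by move=> x; exact: cvg_cst. Qed.

Lemma cont_id (R : realType) : continuous (fun t : R => t).
Proof. by move=> x; exact: cvg_id. Qed.

Lemma cont_min (R : realType) (f g : R -> R) :
  continuous f -> continuous g -> continuous (fun t => Num.min (f t) (g t)).
Proof. by move=> cf cg x; apply: continuous_min; [exact: cf|exact: cg]. Qed.

Ltac cont :=
  cbv beta;
  lazymatch goal with
  | |- continuous (fun _ => ?c) => apply: cont_cst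
  | |- continuous (fun x => x) => apply: cont_id
  | |- continuous (fun x => GRing.add (@?f x) (@?g x)) =>
      apply: (@cont_add _ f g); cont
  | |- continuous (fun x => GRing.opp (@?f x)) =>
      apply: (@cont_opp _ f); cont
  | |- continuous (fun x => GRing.mul (@?f x) (@?g x)) =>
      apply: (@cont_mul _ f g); cont
  | |- continuous (fun x => GRing.exp (@?f x) 2) =>
      apply: (@cont_sqr _ f); cont
  | |- continuous (fun x => expR (@?f x)) =>
      apply: (@cont_expR _ f); cont
  | |- _ => eassumption
  end.

Lemma le_of_derive_ge0 (R : realType) (f : R -> R) (a b : R) :
  a <= b -> continuous f ->
  (forall t, a < t < b -> exists2 d, is_derive t 1 f d & 0 <= d) ->
  f a <= f b.
Proof.
move=> ab cf H.
have D t : t \in `]a, b[%R -> derivable f t 1.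
  by rewrite in_itv /= => /H[d /@ex_derive].
apply: (@ger0_derive1_le_cc _ f a b) => //.
- move=> t; rewrite in_itv /= => /H[d fd d0].
  by rewrite derive1E (@derive_val _ _ _ _ _ _ _ fd).
- exact: continuous_subspaceT.
- by rewrite in_itv /= lexx.
- by rewrite in_itv /= lexx ab.
Qed.

Lemma ge_of_derive_le0 (R : realType) (f : R -> R) (a b : R) :
  a <= b -> continuous f ->
  (forall t, a < t < b -> exists2 d, is_derive t 1 f d & d <= 0) ->
  f b <= f a.
Proof.
move=> ab cf H; rewrite -lerN2.
apply: (@le_of_derive_ge0 _ (fun t => - f t)) => //; first by cont.
move=> t /H[d fd d0]; exists (- d); first by deriv.
by rewrite oppr_ge0.
Qed.

Lemma lt_of_derive_gt0 (R : realType) (f : R -> R) (a b : R) :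
  a < b -> continuous f ->
  (forall t, a < t < b -> exists2 d, is_derive t 1 f d & 0 < d) ->
  f a < f b.
Proof.
move=> ab cf H.
have D t : t \in `]a, b[%R -> derivable f t 1.
  by rewrite in_itv /= => /H[d /@ex_derive].
apply: (@gtr0_derive1_lt_cc _ f a b) => //.
- move=> t; rewrite in_itv /= => /H[d fd d0].
  by rewrite derive1E (@derive_val _ _ _ _ _ _ _ fd).
- exact: continuous_subspaceT.
- by rewrite in_itv /= lexx ltW.
- by rewrite in_itv /= lexx ltW.
Qed.

Lemma eq_of_derive_eq0 (R : realType) (f : R -> R) (a b : R) :
  a <= b -> continuous f -> (forall t, a < t < b -> is_derive t 1 f 0) ->
  f b = f a.
Proof.
move=> ab cf H; apply/eqP; rewrite eq_le; apply/andP; split.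
  by apply: ge_of_derive_le0 => // t /H; exists 0.
by apply: le_of_derive_ge0 => // t /H; exists 0.
Qed.

(** The function f(t) e^(k t) is nondecreasing. *)
Lemma gronwall_lower (R : realType) (f : R -> R) (k a b : R) :
  a <= b -> continuous f ->
  (forall t, a < t < b -> exists2 d, is_derive t 1 f d & - k * f t <= d) ->
  f a * expR (- k * (b - a)) <= f b.
Proof.
move=> ab cf H.
have : f a * expR (k * (a - a)) <= f b * expR (k * (b - a)).
  apply: (@le_of_derive_ge0 _ (fun t => f t * expR (k * (t - a)))) => //.
    by cont.
  move=> t /H[d fd hd]; exists (expR (k * (t - a)) * (d + k * f t)).
    by eapply der_eq; [deriv|ring].
  by rewrite mulr_ge0 ?expR_ge0 //; lra.
rewrite subrr mulr0 expR0 mulr1 mulNr expRN => h.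
by rewrite ler_pdivrMr ?expR_gt0.
Qed.

Lemma continuous_bootstrap2 (R : realType) (g h : R -> R) (a b : R) :
  continuous g -> continuous h -> 0 < g a -> 0 < h a ->
  (forall c, a < c -> c <= b -> (forall s, a <= s < c -> 0 < g s /\ 0 < h s) ->
     0 < g c /\ 0 < h c) ->
  forall t, a <= t <= b -> 0 < g t /\ 0 < h t.
Proof.
move=> cg ch ga ha H t tab.
suff : 0 < Num.min (g t) (h t) by rewrite lt_min => /andP[].
apply: (@continuous_bootstrap _ (fun t => Num.min (g t) (h t)) a b) => //.
- exact: cont_min.
- by rewrite lt_min ga.
- move=> c ac cb below; rewrite lt_min; apply/andP; apply: H => // s /below.
  by rewrite lt_min => /andP.
Qed.

(** The planar equation outside K, written in coordinates and with classical
    derivatives in each of the three open regions where the projection is linear: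
    c and s stand for the cosine and sine of the opening angle, so that
    c x2 - s x1 is the coordinate along the second face and c x1 + s x2 the
    coordinate along its outer normal.  In the polar cone D is |u|' / |u|,
    characterized without division. *)
Record motion (R : realType) (al ka c s : R) (x1 x2 v1 v2 : R -> R) : Prop := Motion {
  mo_x1 : continuous x1; mo_x2 : continuous x2;
  mo_v1 : continuous v1; mo_v2 : continuous v2;
  mo_dx1 : forall t : R, 0 < t -> is_derive t 1 x1 (v1 t);
  mo_dx2 : forall t : R, 0 < t -> is_derive t 1 x2 (v2 t);
  mo_face1 : forall t : R, 0 < t -> 0 < x1 t -> x2 t < 0 ->
    is_derive t 1 v1 (- (2 * al * ka * v1 t + ka ^+ 2 * x1 t)) /\
    is_derive t 1 v2 0;
  mo_polar : forall t : R, 0 < t -> 0 < x2 t -> c * x2 t < s * x1 t ->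
    exists D, [/\ D * (x1 t ^+ 2 + x2 t ^+ 2) = x1 t * v1 t + x2 t * v2 t,
      is_derive t 1 v1 (- (2 * al * ka * D + ka ^+ 2) * x1 t) &
      is_derive t 1 v2 (- (2 * al * ka * D + ka ^+ 2) * x2 t)];
  mo_face2 : forall t : R, 0 < t -> s * x1 t < c * x2 t -> 0 < c * x1 t + s * x2 t ->
    let a := - (2 * al * ka * (c * v1 t + s * v2 t)
                + ka ^+ 2 * (c * x1 t + s * x2 t)) in
    is_derive t 1 v1 (a * c) /\ is_derive t 1 v2 (a * s)
}.

Ltac nonneg :=
  first [ assumption | apply: ltW; assumption | by [] |
  lazymatch goal with
  | |- is_true (0 <= GRing.mul _ _) => apply: mulr_ge0; nonneg
  | |- is_true (0 <= GRing.add _ _) => apply: addr_ge0; nonneg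
  | |- is_true (0 <= GRing.exp _ 2) => apply: sqr_ge0
  | |- is_true (0 <= GRing.inv _) => rewrite invr_ge0; nonneg
  | |- is_true (0 <= expR _) => apply: expR_ge0
  end ].

Ltac posi :=
  first [ assumption | by [] |
  lazymatch goal with
  | |- is_true (0 < GRing.mul _ _) => apply: mulr_gt0; posi
  | |- is_true (0 < GRing.add _ _) => apply: addr_gt0; posi
  | |- is_true (0 < GRing.exp _ 2) => apply: exprn_gt0; posi
  | |- is_true (0 < GRing.inv _) => rewrite invr_gt0; posi
  | |- is_true (0 < expR _) => apply: expR_gt0
  end ].

(** * Sliding along the first face *)

(** Two quantities are carried together by bootstrap: q = x1' + alpha kappa x1,
    which satisfies q' >= - alpha kappa q because alpha > 1, and - x2, which is
    affine.  The last bound comes from the virial function H, the one-dimensional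
    case of the estimate used later in the polar cone. *)
Lemma face1_phase (R : realType) (al ka c s : R) (x1 x2 v1 v2 : R -> R) (t0 : R) :
  motion al ka c s x1 x2 v1 v2 -> 1 < al -> 0 < ka ->
  x1 0 = 0 -> 0 < v1 0 -> x2 0 < 0 -> 0 < v2 0 -> t0 * v2 0 = - x2 0 ->
  [/\ forall t, 0 <= t <= t0 ->
        [/\ x2 t = x2 0 + t * v2 0, v2 t = v2 0, 0 <= x1 t &
          v1 t ^+ 2 + ka ^+ 2 * x1 t ^+ 2 <= v1 0 ^+ 2],
      0 < x1 t0, 0 < v1 t0 + al * ka * x1 t0 &
      ka ^+ 2 * x1 t0 ^+ 2 * (2 * al * ka * t0) <= v1 0 ^+ 2].
Proof.
move=> [c1 c2 cv1 cv2 d1 d2 hA _ _] al1 ka0 x10 v10 x20 v20 t0E.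
have t00 : 0 < t0 by rewrite -(pmulr_lgt0 _ v20) t0E oppr_gt0.
have alka : 0 < al * ka by rewrite mulr_gt0 //; lra.
have al0 : 0 < al by lra.
have al2 : 0 <= al ^+ 2 - 1 by rewrite subr_ge0 expr_ge1 // ltW.
pose q t := v1 t + al * ka * x1 t.
have cq : continuous q by rewrite /q; cont.
(* x1 e^(al ka t) has derivative q e^(al ka t), so q > 0 makes it increase from 0 *)
have x1pos b : (forall t, 0 <= t < b -> 0 < q t) ->
    forall t, 0 < t <= b -> 0 < x1 t.
  move=> qb t /andP[tp tb].
  have : x1 0 * expR (al * ka * 0) < x1 t * expR (al * ka * t).
    apply: (@lt_of_derive_gt0 _ (fun t => x1 t * expR (al * ka * t))) => //.
      by cont.
    move=> r /andP[r0 rt]; have dx := d1 r r0.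
    exists (expR (al * ka * r) * q r).
      by eapply der_eq; [deriv|rewrite /q; ring].
    by rewrite mulr_gt0 ?expR_gt0 // qb // ltW //= (lt_le_trans rt).
  by rewrite x10 mul0r pmulr_lgt0 // expR_gt0.
have x2lin b : (forall t, 0 < t < b -> 0 < x1 t /\ x2 t < 0) ->
    forall t, 0 <= t <= b -> v2 t = v2 0 /\ x2 t = x2 0 + t * v2 0.
  move=> rb t /andP[tp tb].
  have v2E r : 0 <= r <= t -> v2 r = v2 0.
    move=> /andP[r0 rt]; apply: eq_of_derive_eq0 => // u /andP[u0 ur].
    have [|h1 h2] := rb u; first by rewrite u0 (lt_le_trans ur) // (le_trans rt).
    by have [] := hA u u0 h1 h2.
  split; first by rewrite v2E // tp lexx.
  have : x2 t - t * v2 0 = x2 0 - 0 * v2 0.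
    apply: (@eq_of_derive_eq0 _ (fun t => x2 t - t * v2 0)) => //; first by cont.
    move=> r /andP[r0 rt]; have dx := d2 r r0.
    eapply der_eq; first by deriv.
    by rewrite v2E ?(ltW r0) ?(ltW rt) //; ring.
  by rewrite mul0r => h; lra.
have pos b : 0 <= b -> b < t0 -> forall t, 0 <= t <= b -> 0 < q t /\ 0 < - x2 t.
  move=> b0 bt0; apply: continuous_bootstrap2 => //.
  - by cont.
  - by rewrite /q x10 mulr0 addr0.
  - by rewrite oppr_gt0.
  move=> e e0 eb below.
  have x1p : forall t, 0 < t <= e -> 0 < x1 t by apply: x1pos => t /below[].
  have reg t : 0 < t < e -> 0 < x1 t /\ x2 t < 0.
    move=> /andP[t1 t2]; split; first by apply: x1p; rewrite t1 ltW.
    by have [|_] := below t; rewrite ?(ltW t1) // oppr_gt0.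
  split.
    have := @gronwall_lower _ q (al * ka) 0 e (ltW e0) cq.
    have qq : 0 < q 0 by rewrite /q x10 mulr0 addr0.
    move=> H; apply: (lt_le_trans _ (H _)).
      by rewrite mulr_gt0 ?expR_gt0.
    move=> t te; have [r1 r2] := reg t te; move: te => /andP[tp te].
    have [dv1 _] := hA t tp r1 r2; have dx := d1 t tp.
    eexists; first by rewrite /q; deriv.
    rewrite /q -subr_ge0 (_ : _ - _ = (al ^+ 2 - 1) * ka ^+ 2 * x1 t); last by ring.
    by nonneg.
  have [|_ ->] := x2lin e reg e; first by rewrite ltW /=.
  have : e * v2 0 < t0 * v2 0 by rewrite ltr_pM2r // (le_lt_trans eb).
  lra.
have qpos t : 0 <= t < t0 -> 0 < q t.
  by move=> /andP[tp tt]; have [|//] := pos t tp tt t; rewrite tp lexx.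
have x1p := x1pos t0 qpos.
have reg t : 0 < t < t0 -> 0 < x1 t /\ x2 t < 0.
  move=> /andP[tp tt]; split; first by apply: x1p; rewrite tp ltW.
  have := pos t (ltW tp) tt t; rewrite (ltW tp) lexx => /(_ isT)[_].
  by rewrite oppr_gt0.
have lin := x2lin t0 reg.
have E1 t : 0 <= t <= t0 -> v1 t ^+ 2 + ka ^+ 2 * x1 t ^+ 2 <= v1 0 ^+ 2.
  move=> /andP[tp tt].
  have -> : v1 0 ^+ 2 = v1 0 ^+ 2 + ka ^+ 2 * x1 0 ^+ 2 by rewrite x10; ring.
  apply: (@ge_of_derive_le0 _ (fun t => v1 t ^+ 2 + ka ^+ 2 * x1 t ^+ 2)) => //.
    by cont.
  move=> r /andP[r0 rt]; have [|r1 r2] := reg r; first by rewrite r0 (lt_le_trans rt).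
  have [dv1 _] := hA r r0 r1 r2; have dx := d1 r r0.
  exists (- (4 * (al * ka) * v1 r ^+ 2)); first by eapply der_eq; [deriv|ring].
  by rewrite oppr_le0; nonneg.
have x1t0 : 0 < x1 t0 by apply: x1p; rewrite t00 lexx.
split=> //.
- move=> t tt; have [h1 h2] := lin t tt; split=> //; last exact: E1.
  move: tt => /andP[]; rewrite le_eqVlt => /predU1P[<- _|tp tt].
    by rewrite x10.
  by rewrite ltW // x1p // tp.
- have := @gronwall_lower _ q (al * ka) 0 t0 (ltW t00) cq.
  have qq : 0 < q 0 by rewrite /q x10 mulr0 addr0.
  move=> H; apply: (lt_le_trans _ (H _)).
    by rewrite mulr_gt0 ?expR_gt0.
  move=> t te; have [r1 r2] := reg t te; move: te => /andP[tp te].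
  have [dv1 _] := hA t tp r1 r2; have dx := d1 t tp.
  eexists; first by rewrite /q; deriv.
  rewrite /q -subr_ge0 (_ : _ - _ = (al ^+ 2 - 1) * ka ^+ 2 * x1 t); last by ring.
  by nonneg.
(* along the motion x1 v1 + al ka x1^2 + N / (2 al ka) has derivative - N *)
- pose N t := v1 t ^+ 2 + ka ^+ 2 * x1 t ^+ 2.
  pose H t := (2 * al * ka) * (x1 t * v1 t + al * ka * x1 t ^+ 2 + t * N t) + N t.
  have : H t0 <= H 0.
    apply: ge_of_derive_le0; first exact: ltW.
      by rewrite /H /N; cont.
    move=> r /[dup] rr /andP[r0 rt]; have [r1 r2] := reg r rr.
    have [dv1 _] := hA r r0 r1 r2; have dx := d1 r r0.
    exists (- (8 * (al * ka) ^+ 2 * r * v1 r ^+ 2)).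
      by rewrite /H /N; eapply der_eq; [deriv|ring].
    by rewrite oppr_le0; nonneg.
  rewrite /H /N x10 => h.
  have : 0 <= (2 * al * ka) * (x1 t0 * v1 t0 + al * ka * x1 t0 ^+ 2) +
      v1 t0 ^+ 2 + ka ^+ 2 * x1 t0 ^+ 2.
    rewrite (_ : _ + _ = (v1 t0 + al * ka * x1 t0) ^+ 2 +
      (al ^+ 2 + 1) * (ka * x1 t0) ^+ 2); last by ring.
    by nonneg.
  have : 0 <= 2 * al * ka * t0 * v1 t0 ^+ 2.
    by nonneg.
  lra.
Qed.

(** * Conserved and monotone quantities *)

Section PolarPhase.
Context {R : realType} (al ka c s : R) (x1 x2 v1 v2 : R -> R).

Definition polar_region (t : R) := 0 < x2 t /\ c * x2 t < s * x1 t.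
Definition face2_region (t : R) := s * x1 t < c * x2 t /\ 0 < c * x1 t + s * x2 t.

Definition sqdist (t : R) := x1 t ^+ 2 + x2 t ^+ 2.
Definition angmom (t : R) := x1 t * v2 t - x2 t * v1 t.
(** Twice the mechanical energy in the polar cone, where the distance to K is |u|. *)
Definition energy (t : R) := v1 t ^+ 2 + v2 t ^+ 2 + ka ^+ 2 * (x1 t ^+ 2 + x2 t ^+ 2).
(** The product |u| (|u|' + alpha kappa |u|). *)
Definition radial (t : R) :=
  x1 t * v1 t + x2 t * v2 t + al * ka * (x1 t ^+ 2 + x2 t ^+ 2).
(** A Lyapunov function: along the motion its derivative is at most
    2 alpha kappa (2 L^2 / |u|^2 - eta) for t >= a0, with L the angular momentum. *)
Definition virial (a0 eta t : R) :=
  2 * al * ka * (radial t + (t - a0) * (energy t - eta)) + energy t.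

Definition ycoord (t : R) := c * x1 t + s * x2 t.
Definition yspeed (t : R) := c * v1 t + s * v2 t.
Definition zspeed (t : R) := c * v2 t - s * v1 t.
(** Twice the mechanical energy near the second face, where the distance to K is
    u.n. *)
Definition energy2 (t : R) :=
  v1 t ^+ 2 + v2 t ^+ 2 + ka ^+ 2 * (c * x1 t + s * x2 t) ^+ 2.
Definition radial2 (t : R) :=
  (c * x1 t + s * x2 t) * (c * v1 t + s * v2 t) +
  al * ka * (c * x1 t + s * x2 t) ^+ 2.
Definition virial2 (a0 eta t : R) :=
  2 * al * ka * (radial2 t + (t - a0) * (energy2 t - eta)) + energy2 t.

Hypothesis mo : motion al ka c s x1 x2 v1 v2.
Hypothesis al1 : 1 < al.
Hypothesis ka0 : 0 < ka.

Let al0 : 0 < al. Proof. by apply: lt_trans al1. Qed.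
Let alka : 0 < al * ka. Proof. by rewrite mulr_gt0. Qed.
Let al2 : 0 <= al ^+ 2 - 1. Proof. by rewrite subr_ge0 expr_ge1 // ltW. Qed.
Let c1 := mo_x1 mo.
Let c2 := mo_x2 mo.
Let cv1 := mo_v1 mo.
Let cv2 := mo_v2 mo.

Lemma polar_step (a b t : R) : 0 <= a -> (forall t, a < t < b -> polar_region t) ->
  a < t < b -> exists D,
    [/\ D * (x1 t ^+ 2 + x2 t ^+ 2) = x1 t * v1 t + x2 t * v2 t,
      is_derive t 1 x1 (v1 t), is_derive t 1 x2 (v2 t),
      is_derive t 1 v1 (- (2 * al * ka * D + ka ^+ 2) * x1 t) &
      is_derive t 1 v2 (- (2 * al * ka * D + ka ^+ 2) * x2 t)].
Proof.
move=> a0 reg tab; have t0 : 0 < t by case/andP: tab => h _; exact: le_lt_trans h.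
have [r1 r2] := reg t tab; have [D [hD dv1 dv2]] := mo_polar mo t0 r1 r2.
by exists D; split=> //; [exact: mo_dx1 mo _ _|exact: mo_dx2 mo _ _].
Qed.

(** The whole force is central in the polar cone. *)
Lemma angmom_polar (a b : R) : 0 <= a -> a <= b ->
  (forall t, a < t < b -> polar_region t) -> angmom b = angmom a.
Proof.
move=> a0 ab reg; apply: eq_of_derive_eq0 => //; first by rewrite /angmom; cont.
move=> t /(polar_step a0 reg)[D [hD dx1 dx2 dv1 dv2]].
by rewrite /angmom; eapply der_eq; [deriv|ring].
Qed.

(** Along the motion the derivative is - 4 alpha kappa |u|'^2: the damping acts
    on the radial velocity only. *)
Lemma energy_polar (a b : R) : 0 <= a -> a <= b ->
  (forall t, a < t < b -> polar_region t) -> energy b <= energy a.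
Proof.
move=> a0 ab reg; apply: ge_of_derive_le0 => //; first by rewrite /energy; cont.
move=> t /(polar_step a0 reg)[D [hD dx1 dx2 dv1 dv2]].
exists (- (4 * (al * ka)) * (D * (x1 t * v1 t + x2 t * v2 t))).
  by rewrite /energy; eapply der_eq; [deriv|ring].
rewrite -hD (_ : _ * _ = - (4 * (al * ka) * (D ^+ 2 * (x1 t ^+ 2 + x2 t ^+ 2)))); last by ring.
by rewrite oppr_le0; nonneg.
Qed.

(** This is where alpha > 1 enters.  The radial velocity |u|' stays above
    - alpha kappa |u|, because - alpha lies strictly between the two
    characteristic exponents of the overdamped radial oscillator. *)
Lemma radial_polar (a b : R) : 0 <= a -> a <= b ->
  (forall t, a < t < b -> polar_region t) ->
  radial a * expR (- (2 * al * ka) * (b - a)) <= radial b.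
Proof.
move=> a0 ab reg; apply: gronwall_lower => //; first by rewrite /radial; cont.
move=> t /(polar_step a0 reg)[D [hD dx1 dx2 dv1 dv2]].
exists (v1 t ^+ 2 + v2 t ^+ 2 + 2 * al * ka * (x1 t * v1 t + x2 t * v2 t)
   - 2 * al * ka * (D * (x1 t ^+ 2 + x2 t ^+ 2)) - ka ^+ 2 * (x1 t ^+ 2 + x2 t ^+ 2)).
  by rewrite /radial; eapply der_eq; [deriv|ring].
rewrite hD /radial -subr_ge0.
have -> : v1 t ^+ 2 + v2 t ^+ 2 = (v1 t - D * x1 t) ^+ 2 + (v2 t - D * x2 t) ^+ 2
   + 2 * D * (x1 t * v1 t + x2 t * v2 t) - D ^+ 2 * (x1 t ^+ 2 + x2 t ^+ 2) by ring.
rewrite -hD.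
rewrite (_ : _ - _ = (v1 t - D * x1 t) ^+ 2 + (v2 t - D * x2 t) ^+ 2
   + (D + al * ka) ^+ 2 * (x1 t ^+ 2 + x2 t ^+ 2)
   + (al ^+ 2 - 1) * (ka ^+ 2 * (x1 t ^+ 2 + x2 t ^+ 2))); last by ring.
by nonneg.
Qed.

Lemma sqdist_polar (a b : R) : 0 <= a -> a <= b -> 0 <= radial a ->
  (forall t, a < t < b -> polar_region t) ->
  sqdist a * expR (- (2 * al * ka) * (b - a)) <= sqdist b.
Proof.
move=> a0 ab ra reg; apply: gronwall_lower => //; first by rewrite /sqdist; cont.
move=> t tab; have [D [hD dx1 dx2 dv1 dv2]] := polar_step a0 reg tab.
case/andP: tab => ta tb.
exists (2 * (x1 t * v1 t + x2 t * v2 t)).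
  by rewrite /sqdist; eapply der_eq; [deriv|ring].
have : 0 <= radial t.
  have := @radial_polar a t a0 (ltW ta).
  move=> H; apply: le_trans (H _); first by nonneg.
  by move=> r /andP[r1 r2]; apply: reg; rewrite r1 (lt_trans r2).
rewrite /radial /sqdist; lra.
Qed.

(** The derivative of [radial] is |v|^2 - kappa^2 |u|^2, and adding the derivative
    of the energy over 2 alpha kappa turns it into - energy + 2 L^2 / |u|^2, where
    L is the angular momentum and L / |u| the tangential speed.  The term
    (t - a0) energy t compensates for - energy, up to the derivative of the
    energy, which is nonpositive. *)
Lemma virial_polar (a0 eta a b : R) : 0 <= a -> a0 <= a -> a <= b ->
  (forall t, a < t < b -> polar_region t) ->
  (forall t, a < t < b -> 2 * angmom t ^+ 2 <= eta * sqdist t) ->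
  virial a0 eta b <= virial a0 eta a.
Proof.
move=> a_ge0 a0a ab reg hL; apply: ge_of_derive_le0 => //.
  by rewrite /virial /radial /energy; cont.
move=> t tab; have [D [hD dx1 dx2 dv1 dv2]] := polar_step a_ge0 reg tab.
(* the squared tangential speed *)
pose W := (v1 t - D * x1 t) ^+ 2 + (v2 t - D * x2 t) ^+ 2.
exists (2 * (al * ka) * (2 * (v1 t ^+ 2 + v2 t ^+ 2) - eta
    - 2 * (D * (x1 t * v1 t + x2 t * v2 t))
    + 2 * (al * ka) * (x1 t * v1 t + x2 t * v2 t - D * (x1 t ^+ 2 + x2 t ^+ 2))
    - (t - a0) * (4 * (al * ka) * (D * (x1 t * v1 t + x2 t * v2 t))))).
  by rewrite /virial /radial /energy; eapply der_eq; [deriv|ring].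
rewrite hD subrr mulr0 addr0.
have -> : v1 t ^+ 2 + v2 t ^+ 2 = W
   + 2 * (D * (x1 t * v1 t + x2 t * v2 t)) - D ^+ 2 * (x1 t ^+ 2 + x2 t ^+ 2).
  by rewrite /W; ring.
have WE : W * sqdist t = angmom t ^+ 2.
  have -> : W * sqdist t = angmom t ^+ 2 +
     (D * (x1 t ^+ 2 + x2 t ^+ 2) - (x1 t * v1 t + x2 t * v2 t)) ^+ 2.
    by rewrite /W /angmom /sqdist; ring.
  by rewrite hD subrr expr0n addr0.
have W2 : 2 * W <= eta.
  have [x20 _] := reg t tab.
  have p : 0 < sqdist t.
    by rewrite /sqdist ltr_pwDr ?sqr_ge0 // exprn_gt0.
  by rewrite -(ler_pM2r p) -mulrA WE hL.
case/andP: tab => ta tb; have ta0 : 0 <= t - a0 by lra.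
rewrite -hD pmulr_rle0; last by rewrite mulr_gt0.
have : 0 <= (t - a0) * (4 * (al * ka) * (D ^+ 2 * (x1 t ^+ 2 + x2 t ^+ 2))).
  by nonneg.
have -> : D * (D * (x1 t ^+ 2 + x2 t ^+ 2)) = D ^+ 2 * (x1 t ^+ 2 + x2 t ^+ 2) by ring.
lra.
Qed.

Hypothesis cs1 : c ^+ 2 + s ^+ 2 = 1.

Lemma face2_step (a b t : R) : 0 <= a -> (forall t, a < t < b -> face2_region t) ->
  a < t < b -> exists A, [/\ A = - (2 * al * ka * yspeed t + ka ^+ 2 * ycoord t),
      is_derive t 1 x1 (v1 t), is_derive t 1 x2 (v2 t),
      is_derive t 1 v1 (A * c) & is_derive t 1 v2 (A * s)].
Proof.
move=> a0 reg tab; have t0 : 0 < t by case/andP: tab => h _; exact: le_lt_trans h.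
have [r1 r2] := reg t tab; have [dv1 dv2] := mo_face2 mo t0 r1 r2.
eexists; split; first by []; rewrite /yspeed /ycoord; try eassumption.
  exact: mo_dx1 mo _ _.
exact: mo_dx2 mo _ _.
Qed.

Lemma zspeed_face2 (a b : R) : 0 <= a -> a <= b ->
  (forall t, a < t < b -> face2_region t) -> zspeed b = zspeed a.
Proof.
move=> a0 ab reg; apply: eq_of_derive_eq0 => //; first by rewrite /zspeed; cont.
move=> t /(face2_step a0 reg)[A [hA dx1 dx2 dv1 dv2]].
by rewrite /zspeed; eapply der_eq; [deriv|ring].
Qed.

Lemma energy2_face2 (a b : R) : 0 <= a -> a <= b ->
  (forall t, a < t < b -> face2_region t) -> energy2 b <= energy2 a.
Proof.
move=> a0 ab reg; apply: ge_of_derive_le0 => //; first by rewrite /energy2; cont.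
move=> t /(face2_step a0 reg)[A [hA dx1 dx2 dv1 dv2]].
exists (2 * yspeed t * (A + ka ^+ 2 * ycoord t)).
  by rewrite /energy2 /yspeed /ycoord; eapply der_eq; [deriv|ring].
rewrite hA (_ : _ * _ = - (4 * (al * ka) * yspeed t ^+ 2)); last by ring.
by rewrite oppr_le0; nonneg.
Qed.

(** The counterpart of [radial_polar] for the one-dimensional oscillator u.n. *)
Lemma pushout_face2 (a b : R) : 0 <= a -> a <= b ->
  (forall t, a < t < b -> face2_region t) ->
  (yspeed a + al * ka * ycoord a) * expR (- (al * ka) * (b - a)) <=
  yspeed b + al * ka * ycoord b.
Proof.
move=> a0 ab reg.
apply: (@gronwall_lower _ (fun t => yspeed t + al * ka * ycoord t)) => //.
  by rewrite /yspeed /ycoord; cont.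
move=> t tab; have [A [hA dx1 dx2 dv1 dv2]] := face2_step a0 reg tab.
exists (A + al * ka * yspeed t).
  rewrite /yspeed /ycoord; eapply der_eq; first by deriv.
  rewrite -[X in _ = X + _](mulr1 A) -cs1; ring.
have [_ y0] := reg t tab.
rewrite hA -subr_ge0 (_ : _ - _ = (al ^+ 2 - 1) * (ka ^+ 2 * ycoord t)); last by ring.
by rewrite /ycoord; nonneg.
Qed.

Lemma ycoord_face2 (a b : R) : 0 <= a -> a <= b ->
  0 <= yspeed a + al * ka * ycoord a ->
  (forall t, a < t < b -> face2_region t) ->
  ycoord a * expR (- (al * ka) * (b - a)) <= ycoord b.
Proof.
move=> a0 ab ra reg; apply: gronwall_lower => //; first by rewrite /ycoord; cont.
move=> t tab; have [A [hA dx1 dx2 dv1 dv2]] := face2_step a0 reg tab.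
case/andP: tab => ta tb.
exists (yspeed t).
  by rewrite /ycoord /yspeed; eapply der_eq; [deriv|ring].
have : 0 <= yspeed t + al * ka * ycoord t.
  have H := @pushout_face2 a t a0 (ltW ta).
  apply: le_trans (H _); first by nonneg.
  by move=> r /andP[r1 r2]; apply: reg; rewrite r1 (lt_trans r2).
lra.
Qed.

(** Near the second face the tangential speed is constant and takes the place of
    the quotient L / |u|. *)
Lemma virial_face2 (a0 eta a b : R) : 0 <= a -> a0 <= a -> a <= b ->
  (forall t, a < t < b -> face2_region t) -> zspeed a ^+ 2 <= eta ->
  virial2 a0 eta b <= virial2 a0 eta a.
Proof.
move=> a_ge0 a0a ab reg hz; apply: ge_of_derive_le0 => //.
  by rewrite /virial2 /radial2 /energy2; cont.
move=> t tab; have [A [hA dx1 dx2 dv1 dv2]] := face2_step a_ge0 reg tab.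
case/andP: tab => ta tb; have ta0 : 0 <= t - a0 by lra.
have zE : zspeed t = zspeed a.
  apply: zspeed_face2 => //; first exact: ltW.
  by move=> r /andP[r1 r2]; apply: reg; rewrite r1 (lt_trans r2).
exists (2 * (al * ka) * (yspeed t ^+ 2 + ycoord t * (A * (c ^+ 2 + s ^+ 2))
    + 2 * (al * ka) * ycoord t * yspeed t
    + ((v1 t ^+ 2 + v2 t ^+ 2) + ka ^+ 2 * ycoord t ^+ 2) - eta
    + (t - a0) * (2 * yspeed t * (A + ka ^+ 2 * ycoord t)))
    + 2 * yspeed t * (A + ka ^+ 2 * ycoord t)).
  by rewrite /virial2 /radial2 /energy2 /yspeed /ycoord; eapply der_eq; [deriv|ring].
have -> : v1 t ^+ 2 + v2 t ^+ 2 = yspeed t ^+ 2 + zspeed t ^+ 2.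
  rewrite -[LHS]mulr1 -cs1 /yspeed /zspeed; ring.
rewrite cs1 zE hA.
have : 0 <= (2 * (al * ka)) * ((t - a0) * (4 * (al * ka) * yspeed t ^+ 2)).
  by nonneg.
have : 0 <= (2 * (al * ka)) * (eta - zspeed a ^+ 2).
  by rewrite mulr_ge0 ?subr_ge0 //; nonneg.
move=> h1 h2; rewrite -subr_ge0 sub0r.
apply: le_trans (addr_ge0 h1 h2) _.
by rewrite le_eqVlt; apply/orP; left; apply/eqP; ring.
Qed.

End PolarPhase.

(** * Entering the polar cone *)

Lemma sqr_norm_le (R : realDomainType) (x V : R) : 0 <= V -> x ^+ 2 <= V ^+ 2 -> `|x| <= V.
Proof.
by move=> V0 h; rewrite -ler_sqr ?nnegrE // real_normK ?num_real.
Qed.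

Section Entry.
Context {R : realType} (al ka c s : R) (x1 x2 v1 v2 : R -> R).
Hypothesis mo : motion al ka c s x1 x2 v1 v2.
Hypothesis al1 : 1 < al.
Hypothesis ka0 : 0 < ka.
Hypothesis c_le0 : c <= 0.
Hypothesis s_gt0 : 0 < s.

Local Notation polar := (polar_region c s x1 x2).
Local Notation en := (energy ka x1 x2 v1 v2).

Let al0 : 0 < al. Proof. by apply: lt_trans al1. Qed.
Let alka : 0 < al * ka. Proof. by rewrite mulr_gt0. Qed.
Let c1 := mo_x1 mo.
Let c2 := mo_x2 mo.
Let cv1 := mo_v1 mo.
Let cv2 := mo_v2 mo.

(** The force is bounded by a multiple of kappa although the damping direction
    u / |u| is singular at the origin. *)
Lemma polar_accel_le (t V D : R) : 0 <= V -> en t <= V ^+ 2 ->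
  D * (x1 t ^+ 2 + x2 t ^+ 2) = x1 t * v1 t + x2 t * v2 t ->
  `|(2 * al * ka * D + ka ^+ 2) * x1 t| <= ka * ((2 * al + 1) * V) /\
  `|(2 * al * ka * D + ka ^+ 2) * x2 t| <= ka * ((2 * al + 1) * V).
Proof.
move=> V0 enV hD.
have W : D ^+ 2 * (x1 t ^+ 2 + x2 t ^+ 2) <= v1 t ^+ 2 + v2 t ^+ 2.
  rewrite -subr_ge0.
  rewrite (_ : _ - _ = (v1 t - D * x1 t) ^+ 2 + (v2 t - D * x2 t) ^+ 2).
    by nonneg.
  transitivity (v1 t ^+ 2 + v2 t ^+ 2 + D ^+ 2 * (x1 t ^+ 2 + x2 t ^+ 2)
    - 2 * D * (D * (x1 t ^+ 2 + x2 t ^+ 2))); first by ring.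
  by rewrite hD; ring.
move: enV; rewrite /energy => enV.
have k1 : 0 <= ka ^+ 2 * x1 t ^+ 2 by nonneg.
have k2 : 0 <= ka ^+ 2 * x2 t ^+ 2 by nonneg.
have k3 : 0 <= D ^+ 2 * x1 t ^+ 2 by nonneg.
have k4 : 0 <= D ^+ 2 * x2 t ^+ 2 by nonneg.
have k5 : 0 <= v1 t ^+ 2 + v2 t ^+ 2 by nonneg.
have bound x : D ^+ 2 * x ^+ 2 <= V ^+ 2 -> ka ^+ 2 * x ^+ 2 <= V ^+ 2 ->
    `|(2 * al * ka * D + ka ^+ 2) * x| <= ka * ((2 * al + 1) * V).
  rewrite -!exprMn => /(sqr_norm_le V0) h1 /(sqr_norm_le V0) h2.
  rewrite (_ : _ * x = ka * (2 * al * (D * x) + ka * x)); last by ring.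
  rewrite normrM (gtr0_norm ka0) ler_pM2l //.
  apply: le_trans (ler_normD _ _) _.
  have i1 : `|2 * al * (D * x)| <= 2 * al * V.
    rewrite normrM gtr0_norm; last by rewrite mulr_gt0.
    by rewrite ler_pM2l // mulr_gt0.
  by rewrite (_ : (2 * al + 1) * V = 2 * al * V + V); [exact: lerD|ring].
by split; apply: bound; lra.
Qed.

(** During a time tau the bounded force changes x2' by at most half of its initial
    value and x1 by at most half of x1(t0); the three smallness conditions on tau
    are what this takes. *)
Lemma polar_entry (t0 tau V : R) : 0 < t0 -> 0 < tau -> x2 t0 = 0 -> 0 < x1 t0 ->
  0 < v2 t0 -> 0 <= v1 t0 + al * ka * x1 t0 -> 0 <= V -> en t0 <= V ^+ 2 ->
  4 * (al * ka * tau) <= 1 ->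
  2 * (ka * ((2 * al + 1) * V) * tau) < v2 t0 ->
  4 * (ka * ((2 * al + 1) * V) * tau ^+ 2) <= x1 t0 ->
  forall t, t0 < t <= t0 + tau -> 0 < x1 t /\ v2 t0 / 2 * (t - t0) <= x2 t.
Proof.
set M := ka * _.
move=> t0p taup x20 x10 v20 q0 V0 enV h1 h2 h3.
have M0 : 0 <= M by rewrite /M; nonneg.
have x2low b : (forall t, t0 <= t < b -> 0 < v2 t - v2 t0 / 2) ->
    forall t, t0 <= t <= b -> v2 t0 / 2 * (t - t0) <= x2 t.
  move=> vb t /andP[tt tb].
  have : x2 t0 - v2 t0 / 2 * (t0 - t0) <= x2 t - v2 t0 / 2 * (t - t0).
    apply: (@le_of_derive_ge0 _ (fun t => x2 t - v2 t0 / 2 * (t - t0))) => //.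
      by cont.
    move=> r /andP[r0 rt]; have dx2 := mo_dx2 mo (lt_trans t0p r0).
    exists (v2 r - v2 t0 / 2); first by eapply der_eq; [deriv|ring].
    by apply/ltW/vb; rewrite ltW //= (lt_le_trans rt).
  by rewrite subrr mulr0 x20 subr0 subr_ge0.
have main : forall t, t0 <= t <= t0 + tau -> 0 < x1 t /\ 0 < v2 t - v2 t0 / 2.
  apply: continuous_bootstrap2 => //; first by cont.
    by lra.
  move=> e te eb below.
  have x2l := x2low e (fun t h => (below t h).2).
  have reg t : t0 < t < e -> polar t.
    move=> /andP[tt et]; have tte : t0 <= t < e by rewrite ltW.
    have x1p := (below t tte).1.
    have x2p : 0 < x2 t.
      apply: lt_le_trans (x2l t _); last by rewrite !ltW.
      by rewrite mulr_gt0 ?subr_gt0 // divr_gt0.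
    split=> //; apply: (@le_lt_trans _ _ 0); last by rewrite mulr_gt0.
    by rewrite mulr_le0_ge0 // ltW.
  have enb t : t0 <= t <= e -> en t <= V ^+ 2.
    move=> /andP[tt et]; apply: le_trans enV.
    apply: (energy_polar mo) => //; first exact: ltW.
    by move=> r /andP[r0 r1]; apply: reg; rewrite r0 (lt_le_trans r1).
  have acc t : t0 < t < e -> exists d1 d2, [/\ is_derive t 1 v1 d1,
      is_derive t 1 v2 d2, - M <= d1 & - M <= d2].
    move=> tt; have [D [hD dx1 dx2 dv1 dv2]] := polar_step mo (ltW t0p) reg tt.
    have [|a1 a2] := polar_accel_le V0 _ hD.
      by apply: enb; case/andP: tt => /ltW -> /ltW ->.
    do 2 eexists; split; [exact: dv1|exact: dv2| |].
      by rewrite mulNr lerN2; apply: le_trans a1; exact: ler_norm.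
    by rewrite mulNr lerN2; apply: le_trans a2; exact: ler_norm.
  have v1l t : t0 <= t <= e -> v1 t0 - M * (t - t0) <= v1 t.
    move=> /andP[tt et].
    have : v1 t0 + M * (t0 - t0) <= v1 t + M * (t - t0).
      apply: (@le_of_derive_ge0 _ (fun t => v1 t + M * (t - t0))) => //.
        by cont.
      move=> r /andP[r0 rt]; have [|d1 [d2 [dv1 dv2 m1 m2]]] := acc r.
        by rewrite r0 (lt_le_trans rt).
      exists (d1 + M); first by eapply der_eq; [deriv|ring].
      lra.
    lra.
  split.
    have : x1 t0 + (al * ka * x1 t0 + M * tau) * (t0 - t0) <=
           x1 e + (al * ka * x1 t0 + M * tau) * (e - t0).
      apply: (@le_of_derive_ge0 _
        (fun t => x1 t + (al * ka * x1 t0 + M * tau) * (t - t0))) => //.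
      - exact: ltW.
      - by cont.
      move=> r /andP[r0 rt]; have dx1 := mo_dx1 mo (lt_trans t0p r0).
      exists (v1 r + (al * ka * x1 t0 + M * tau)); first by eapply der_eq; [deriv|ring].
      have := v1l r; rewrite (ltW r0) (ltW rt) => /(_ isT).
      have : M * (r - t0) <= M * tau by rewrite ler_wpM2l //; lra.
      lra.
    have : (al * ka * x1 t0 + M * tau) * (e - t0) <= (al * ka * x1 t0 + M * tau) * tau.
      by rewrite ler_wpM2l //; [nonneg|lra].
    have : 4 * (al * ka * tau) * x1 t0 <= 1 * x1 t0 by rewrite ler_wpM2r // ltW.
    lra.
  have : v2 t0 + M * (t0 - t0) <= v2 e + M * (e - t0).
    apply: (@le_of_derive_ge0 _ (fun t => v2 t + M * (t - t0))) => //.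
    - exact: ltW.
    - by cont.
    move=> r rr; have [d1 [d2 [dv1 dv2 m1 m2]]] := acc r rr.
    exists (d2 + M); first by eapply der_eq; [deriv|ring].
    lra.
  have : M * (e - t0) <= M * tau by rewrite ler_wpM2l //; lra.
  lra.
move=> t /andP[tt et]; split.
  by have [] := main t; rewrite ?et ?ltW.
apply: (x2low (t0 + tau)); last by rewrite et ltW.
move=> r /andP[r0 r1].
by have [] := main r; rewrite ?r0 ?ltW.
Qed.

End Entry.

(** * Leaving the polar cone, and decay of the energy *)

Section ExitAndDecay.
Context {R : realType} (al ka c s : R) (x1 x2 v1 v2 : R -> R).
Hypothesis mo : motion al ka c s x1 x2 v1 v2.
Hypothesis al1 : 1 < al.
Hypothesis ka0 : 0 < ka.
Hypothesis cs1 : c ^+ 2 + s ^+ 2 = 1.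
Hypothesis s_gt0 : 0 < s.

Local Notation polar := (polar_region c s x1 x2).
Local Notation face2 := (face2_region c s x1 x2).
Local Notation sqd := (sqdist x1 x2).
Local Notation mom := (angmom x1 x2 v1 v2).
Local Notation en := (energy ka x1 x2 v1 v2).
Local Notation en2 := (energy2 ka c s x1 x2 v1 v2).
Local Notation rad := (radial al ka x1 x2 v1 v2).
Local Notation rad2 := (radial2 al ka c s x1 x2 v1 v2).
Local Notation vir := (virial al ka x1 x2 v1 v2).
Local Notation vir2 := (virial2 al ka c s x1 x2 v1 v2).
Local Notation y := (ycoord c s x1 x2).
Local Notation p := (yspeed c s v1 v2).
Local Notation r := (zspeed c s v1 v2).

Let al0 : 0 < al. Proof. by apply: lt_trans al1. Qed.
Let alka : 0 < al * ka. Proof. by rewrite mulr_gt0. Qed.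
Let c1 := mo_x1 mo.
Let c2 := mo_x2 mo.
Let cv1 := mo_v1 mo.
Let cv2 := mo_v2 mo.

(** The tangential speed r is a positive constant, so u.m increases from 0, and
    u.n stays positive as an overdamped oscillator pushed in the right direction. *)
Lemma face2_forever (e T : R) : 0 <= e -> e <= T -> 0 < y e -> 0 < r e ->
  s * x1 e = c * x2 e -> 0 <= p e + al * ka * y e ->
  forall t, e < t < T -> face2 t.
Proof.
move=> e0 eT ye re ze pe.
pose z t := c * x2 t - s * x1 t.
have cz : continuous z by rewrite /z; cont.
have zpos b : e < b -> (forall t, e <= t < b -> 0 < r t) ->
    forall t, e < t <= b -> 0 < z t.
  move=> eb rb t /andP[et tb].
  have -> : 0 = z e by rewrite /z ze subrr.
  apply: lt_of_derive_gt0 => // q /andP[q0 qt].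
  have q1 : 0 < q by exact: le_lt_trans q0.
  have dx1 := mo_dx1 mo q1; have dx2 := mo_dx2 mo q1.
  exists (r q); first by rewrite /z /zspeed; eapply der_eq; [deriv|ring].
  by apply: rb; rewrite ltW //= (lt_le_trans qt).
have main : forall t, e <= t <= T -> 0 < y t /\ 0 < r t - r e / 2.
  apply: continuous_bootstrap2 => //.
  - by rewrite /ycoord; cont.
  - by rewrite /zspeed; cont.
  - by lra.
  move=> f ef fT below.
  have zp := zpos f ef (fun t h => ltac:(have [_] := below t h; lra)).
  have reg t : e < t < f -> face2 t.
    move=> /andP[et tf]; have et' : e <= t < f by rewrite ltW.
    split; last by have [] := below t et'.
    by rewrite -subr_gt0; apply: zp; rewrite et ltW.
  split.
    have := ycoord_face2 mo al1 cs1 e0 (ltW ef) pe reg.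
    by apply: lt_le_trans; rewrite mulr_gt0 ?expR_gt0.
  have -> := zspeed_face2 mo e0 (ltW ef) reg; lra.
move=> t /andP[et tT]; split; last by have [] := main t; rewrite ?ltW.
rewrite -subr_gt0; apply: (zpos T) => //; last by rewrite et ltW.
- exact: lt_trans tT.
- by move=> q /andP[q0 q1]; have [|_] := main q; [rewrite q0 ltW|lra].
Qed.

(** At the first time te at which the point is no longer in the polar cone, either
    x2 = 0 or u.m = 0.  In the first case the conserved positive angular momentum
    equals x1 x2', so that x2 would be increasing at te although it was positive
    before. *)
Lemma polar_exit (t0 a0 T : R) : 0 < t0 -> t0 < a0 -> a0 < T ->
  (forall t, t0 < t <= a0 -> polar t) -> 0 < mom t0 -> 0 <= rad t0 ->
  exists te, [/\ a0 < te, te <= T, forall t, t0 < t < te -> polar t &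
    te = T \/ [/\ s * x1 te = c * x2 te, r te ^+ 2 * sqd te = mom t0 ^+ 2 &
                 forall t, te < t < T -> face2 t]].
Proof.
move=> t0p ta aT reg L0 Q0.
have [all_polar|] := pselect (forall t, a0 <= t <= T -> polar t).
  exists T; split=> //; last by left.
  move=> t /andP[tt tT]; case: (leP t a0) => h; first by apply: reg; rewrite tt.
  by apply: all_polar; rewrite !ltW.
move=> /existsNP[t1 /not_implyP[/andP[at1 t1T] npol]].
pose g t := Num.min (x2 t) (s * x1 t - c * x2 t).
have gpos t : 0 < g t <-> polar t.
  by rewrite /g lt_min subr_gt0; split=> [/andP|[-> ->]].
have cg : continuous g by apply: cont_min => //; cont.
have g1 : g t1 <= 0 by rewrite leNgt; apply/negP => /gpos.
have ga : 0 < g a0 by apply/gpos/reg; rewrite ta lexx.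
have [te [ate tet1 gte below]] := first_nonpos cg ga at1 g1.
have teT : te <= T by exact: le_trans t1T.
have tte : t0 < te by exact: lt_trans ate.
have reg' t : t0 < t < te -> polar t.
  move=> /andP[tt tT]; case: (leP t a0) => h; first by apply: reg; rewrite tt.
  by apply/gpos/below; rewrite ltW.
exists te; split=> //; right.
have LE : mom te = mom t0 by apply: (angmom_polar mo) => //; exact: ltW.
have x2te : 0 <= x2 te.
  by have : 0 <= g te by [rewrite gte]; rewrite /g le_min => /andP[].
have zte : 0 <= s * x1 te - c * x2 te.
  by have : 0 <= g te by [rewrite gte]; rewrite /g le_min => /andP[].
have x2p : 0 < x2 te.
  rewrite lt_neqAle x2te andbT; apply/eqP => x2e.
  (* the angular momentum forbids leaving through x2 = 0 *)
  have x1e : 0 <= x1 te.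
    by move: zte; rewrite -x2e mulr0 subr0 pmulr_rge0.
  have v2e : 0 < v2 te.
    rewrite -(pmulr_rgt0 (v2 te) (x := x1 te)).
      by have := L0; rewrite -LE /angmom -x2e mul0r subr0.
    rewrite lt_neqAle x1e andbT; apply/eqP => x1e0.
    by have := L0; rewrite -LE /angmom -x2e -x1e0 !mul0r subr0 ltxx.
  have : {for te, continuous v2} by exact: (mo_v2 mo).
  move=> /cvgrPdist_lt /(_ _ v2e) /nbhs_ballP[d /= d0 hd].
  pose b := Num.max a0 (te - d / 2).
  have bte : b < te by rewrite /b gt_max ate; lra.
  have t0b : t0 < b by rewrite /b lt_max ta.
  have [bp _] := reg' b (introT andP (conj t0b bte)).
  have : x2 b < x2 te.
    apply: lt_of_derive_gt0 => // q /andP[q0 qt].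
    have q1 : 0 < q by apply: lt_trans q0; exact: (lt_trans t0p).
    exists (v2 q); first exact: (mo_dx2 mo q1).
    have : te - d / 2 < q by apply: le_lt_trans q0; rewrite /b le_max lexx orbT.
    move=> tq; have := hd q; rewrite /ball /= => /(_ _).
    rewrite gtr0_norm ?subr_gt0 // => /(_ ltac:(lra)).
    by move=> /ltr_normlP[]; lra.
  by rewrite -x2e; lra.
have ze : s * x1 te = c * x2 te.
  apply/eqP; rewrite -subr_eq0; apply/eqP.
  move: gte; rewrite /g minEle; case: ifP => // _ x2e.
  by move: x2p; rewrite x2e ltxx.
have sy : s * y te = x2 te.
  rewrite /ycoord mulrDr mulrCA ze -[RHS]mul1r -cs1; ring.
have yp : 0 < y te by rewrite -(pmulr_rgt0 _ s_gt0) sy.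
have Lyr : y te * r te = mom t0.
  have : y te * r te - (c * x2 te - s * x1 te) * p te = (c ^+ 2 + s ^+ 2) * mom te.
    by rewrite /ycoord /zspeed /yspeed /angmom; ring.
  by rewrite ze subrr mul0r subr0 cs1 mul1r LE.
have sqE : sqd te = y te ^+ 2.
  have : (c ^+ 2 + s ^+ 2) * sqd te = y te ^+ 2 + (c * x2 te - s * x1 te) ^+ 2.
    by rewrite /sqdist /ycoord; ring.
  by rewrite ze subrr expr0n addr0 cs1 mul1r.
split=> //.
  by rewrite sqE -exprMn mulrC Lyr.
apply: face2_forever => //.
- exact/ltW/(lt_trans t0p).
- by rewrite -(pmulr_rgt0 _ yp) Lyr.
rewrite -(pmulr_rge0 _ yp).
have -> : y te * (p te + al * ka * y te) = rad te.
  have : rad te * (c ^+ 2 + s ^+ 2) = y te * (p te + al * ka * y te) +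
     (c * x2 te - s * x1 te) * (r te + al * ka * (c * x2 te - s * x1 te)).
    by rewrite /radial /ycoord /yspeed /zspeed; ring.
  by rewrite ze subrr mul0r addr0 cs1 mulr1.
have := radial_polar mo al1 (ltW t0p) (ltW tte) reg'.
by apply: le_trans; rewrite mulr_ge0 ?expR_ge0.
Qed.

Lemma energy2E (t : R) : s * x1 t = c * x2 t -> en2 t = en t.
Proof.
move=> ze; rewrite /energy2 /energy.
have : (c ^+ 2 + s ^+ 2) * (x1 t ^+ 2 + x2 t ^+ 2) =
    (c * x1 t + s * x2 t) ^+ 2 + (c * x2 t - s * x1 t) ^+ 2 by ring.
by rewrite ze subrr expr0n addr0 cs1 mul1r => ->.
Qed.

Lemma virial2E (a0 eta t : R) : s * x1 t = c * x2 t ->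
  vir2 a0 eta t = vir a0 eta t.
Proof.
move=> ze; rewrite /virial2 /virial energy2E //; congr (_ * (_ + _) + _).
have : rad t * (c ^+ 2 + s ^+ 2) = y t * (p t + al * ka * y t) +
     (c * x2 t - s * x1 t) * (r t + al * ka * (c * x2 t - s * x1 t)).
  by rewrite /radial /ycoord /yspeed /zspeed; ring.
rewrite ze subrr mul0r addr0 cs1 mulr1 => ->.
by rewrite /radial2 /ycoord /yspeed; ring.
Qed.

Lemma radial_le (t : R) :
  2 * al * ka * rad t + en t <= (1 + al + 2 * al ^+ 2) * en t.
Proof.
rewrite -subr_ge0 /radial /energy.
rewrite (_ : _ - _ = al * ((ka * x1 t - v1 t) ^+ 2 + (ka * x2 t - v2 t) ^+ 2)
  + 2 * al ^+ 2 * (v1 t ^+ 2 + v2 t ^+ 2)); last by ring.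
by nonneg.
Qed.

Lemma radial_ge (t : R) : 0 <= 2 * al * ka * rad t + en t.
Proof.
rewrite /radial /energy.
rewrite (_ : _ + _ = (v1 t + al * ka * x1 t) ^+ 2 + (v2 t + al * ka * x2 t) ^+ 2
  + (al ^+ 2 + 1) * (ka ^+ 2 * (x1 t ^+ 2 + x2 t ^+ 2))); last by ring.
by nonneg.
Qed.

Lemma radial2_ge (t : R) : 0 <= 2 * al * ka * rad2 t + en2 t.
Proof.
rewrite /radial2 /energy2.
have -> : v1 t ^+ 2 + v2 t ^+ 2 = p t ^+ 2 + r t ^+ 2.
  rewrite -[LHS]mulr1 -cs1 /yspeed /zspeed; ring.
rewrite (_ : _ + _ = (p t + al * ka * y t) ^+ 2 + r t ^+ 2
  + (al ^+ 2 + 1) * (ka ^+ 2 * y t ^+ 2)); first by nonneg.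
by rewrite /ycoord /yspeed /zspeed; ring.
Qed.

(** After a time S / kappa the excess of the energy over eta, multiplied by
    2 alpha S, is at most the initial value of the virial function, itself at most
    a constant times V^2. *)
Lemma energy_drop (a0 eta S V rad1 en1 : R) : 0 < S -> en a0 <= V ^+ 2 ->
  0 <= 2 * al * ka * rad1 + en1 ->
  2 * al * ka * (rad1 + S / ka * (en1 - eta)) + en1 <= vir a0 eta a0 ->
  en1 <= eta + (1 + al + 2 * al ^+ 2) * V ^+ 2 / (2 * al * S).
Proof.
move=> S0 enV rad1_ge; rewrite /virial subrr mul0r addr0.
have e1 := radial_le a0.
have e2 : (1 + al + 2 * al ^+ 2) * en a0 <= (1 + al + 2 * al ^+ 2) * V ^+ 2.
  by rewrite ler_wpM2l //; nonneg.
have -> : 2 * al * ka * (rad1 + S / ka * (en1 - eta)) =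
    2 * al * ka * rad1 + (en1 - eta) * (2 * al * S).
  by field; rewrite gt_eqF.
have aS : 0 < 2 * al * S by posi.
by move=> h; rewrite -lerBlDl ler_pdivlMr //; lra.
Qed.

Lemma energy_of_virial (a0 eta S V : R) : 0 < S -> en a0 <= V ^+ 2 ->
  vir a0 eta (a0 + S / ka) <= vir a0 eta a0 ->
  en (a0 + S / ka) <= eta + (1 + al + 2 * al ^+ 2) * V ^+ 2 / (2 * al * S).
Proof.
move=> S0 enV h; apply: (energy_drop S0 enV (radial_ge _)).
by apply: le_trans h; rewrite /virial [_ + _ - a0]addrC addKr.
Qed.

Lemma energy2_of_virial2 (a0 eta S V : R) : 0 < S -> en a0 <= V ^+ 2 ->
  vir2 a0 eta (a0 + S / ka) <= vir a0 eta a0 ->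
  en2 (a0 + S / ka) <= eta + (1 + al + 2 * al ^+ 2) * V ^+ 2 / (2 * al * S).
Proof.
move=> S0 enV h; apply: (energy_drop S0 enV (radial2_ge _)).
by apply: le_trans h; rewrite /virial2 [_ + _ - a0]addrC addKr.
Qed.

End ExitAndDecay.

(** The number eta bounds twice the squared tangential speed between t0 + tau and
    the time t0 + tau + S / kappa, through the lower bound on |u| and the value
    x1(t0) x2'(t0) of the angular momentum.  The second face may be reached before
    or after the latter time, or not at all; the energies of the two regions agree
    at the crossing, so the estimates can be chained. *)
Lemma motion_settles (R : realType) (al ka c s : R) (x1 x2 v1 v2 : R -> R)
    (t0 tau V S T : R) :
  motion al ka c s x1 x2 v1 v2 -> 1 < al -> 0 < ka ->
  c ^+ 2 + s ^+ 2 = 1 -> c <= 0 -> 0 < s ->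
  0 < t0 -> 0 < tau -> x2 t0 = 0 -> 0 < x1 t0 ->
  0 < v2 t0 -> 0 < v1 t0 + al * ka * x1 t0 -> 0 <= V ->
  v1 t0 ^+ 2 + v2 t0 ^+ 2 + ka ^+ 2 * x1 t0 ^+ 2 <= V ^+ 2 ->
  4 * (al * ka * tau) <= 1 ->
  2 * (ka * ((2 * al + 1) * V) * tau) < v2 t0 ->
  4 * (ka * ((2 * al + 1) * V) * tau ^+ 2) <= x1 t0 ->
  0 < S -> t0 + tau + S / ka <= T ->
  (forall t, t0 <= t <= T -> v1 t ^+ 2 + v2 t ^+ 2 <= V ^+ 2) /\
  (forall t, t0 + tau + S / ka <= t <= T -> v1 t ^+ 2 + v2 t ^+ 2 <=
     8 * (x1 t0 / tau) ^+ 2 * expR (2 * al * S) +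
     (1 + al + 2 * al ^+ 2) * V ^+ 2 / (2 * al * S)).
Proof.
move=> mo al1 ka0 cs1 c_le0 s_gt0 t0p taup x20 x10 v20 q0 V0 enV h1 h2 h3 S0 t1T.
set a0 := t0 + tau; set t1 := a0 + S / ka.
set eta := 8 * _ * _.
have al0 : 0 < al by exact: lt_trans al1.
have en0 : energy ka x1 x2 v1 v2 t0 <= V ^+ 2.
  by rewrite /energy x20 expr0n addr0.
have ent := polar_entry mo al1 ka0 c_le0 s_gt0 t0p taup x20 x10 v20 (ltW q0)
  V0 en0 h1 h2 h3.
have reg0 t : t0 < t <= a0 -> polar_region c s x1 x2 t.
  move=> tt; have [x1t x2t] := ent t tt; move: tt => /andP[tt _].
  have x2p : 0 < x2 t.
    by apply: lt_le_trans x2t; rewrite mulr_gt0 ?subr_gt0 // divr_gt0.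
  split=> //; apply: (@le_lt_trans _ _ 0); last by rewrite mulr_gt0.
  by rewrite mulr_le0_ge0 // ltW.
have ta0 : t0 < a0 by rewrite ltrDl.
have a0t1 : a0 < t1 by rewrite ltrDl divr_gt0.
have a0T : a0 < T by exact: lt_le_trans t1T.
have LE : angmom x1 x2 v1 v2 t0 = x1 t0 * v2 t0.
  by rewrite /angmom x20 mul0r subr0.
have L0 : 0 < angmom x1 x2 v1 v2 t0 by rewrite LE mulr_gt0.
have Q0 : 0 <= radial al ka x1 x2 v1 v2 t0.
  have -> : radial al ka x1 x2 v1 v2 t0 = x1 t0 * (v1 t0 + al * ka * x1 t0).
    by rewrite /radial x20; ring.
  by rewrite mulr_ge0 // ltW.
have [te [ate teT reg exit]] :=
  polar_exit mo al1 cs1 s_gt0 t0p ta0 a0T reg0 L0 Q0.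
have tte : t0 < te by exact: lt_trans ate.
have regs a b : t0 <= a -> b <= te -> forall t, a < t < b -> polar_region c s x1 x2 t.
  move=> ha hb t /andP[at_ tb]; apply: reg.
  by rewrite (le_lt_trans ha at_) (lt_le_trans tb hb).
have enle a b : t0 <= a -> a <= b -> b <= te ->
    energy ka x1 x2 v1 v2 b <= energy ka x1 x2 v1 v2 a.
  move=> ha ab hb; apply: (energy_polar mo) => //; last exact: regs.
  exact: le_trans (ltW t0p) ha.
have en2le a b : te <= a -> a <= b -> b <= T ->
    energy2 ka c s x1 x2 v1 v2 b <= energy2 ka c s x1 x2 v1 v2 a.
  case: exit => [->|[_ _ reg2]] ha ab hb.
    by have -> : b = a by apply/eqP; rewrite eq_le ab (le_trans hb ha).
  apply: (energy2_face2 mo) => //.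
    exact: le_trans (ltW (lt_trans t0p tte)) ha.
  by move=> t /andP[at_ tb]; apply: reg2; rewrite (le_lt_trans ha at_) (lt_le_trans tb hb).
have speed t : v1 t ^+ 2 + v2 t ^+ 2 <= energy ka x1 x2 v1 v2 t.
  by rewrite /energy lerDl; nonneg.
have speed2 t : v1 t ^+ 2 + v2 t ^+ 2 <= energy2 ka c s x1 x2 v1 v2 t.
  by rewrite /energy2 lerDl; nonneg.
have en2te t : te < t <= T -> energy2 ka c s x1 x2 v1 v2 te = energy ka x1 x2 v1 v2 te.
  move=> /andP[tt tT]; case: exit => [h|[ze _ _]]; last exact: energy2E.
  by move: tt; rewrite h ltNge tT.
split=> [t /andP[tt tT]|].
  case: (leP t te) => tte'.
    by apply: le_trans (speed t) _; apply: le_trans en0; exact: enle.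
  apply: le_trans (speed2 t) _; apply: le_trans en0.
  apply: (@le_trans _ _ (energy2 ka c s x1 x2 v1 v2 te)).
    by apply: en2le => //; exact: ltW.
  by rewrite (en2te t) ?tte' //; apply: enle => //; exact: ltW.
have sqlow t : a0 <= t -> t <= te -> t <= t1 ->
    2 * angmom x1 x2 v1 v2 t ^+ 2 <= eta * sqdist x1 x2 t.
  move=> a0t tte' tt1.
  have -> : angmom x1 x2 v1 v2 t = angmom x1 x2 v1 v2 t0.
    apply: (angmom_polar mo) => //; first exact: ltW.
      exact: le_trans (ltW ta0) a0t.
    exact: regs.
  have ra0 : 0 <= radial al ka x1 x2 v1 v2 a0.
    have := radial_polar mo al1 (ltW t0p) (ltW ta0) (regs _ _ (lexx _) (ltW ate)).
    by apply: le_trans; rewrite mulr_ge0 ?expR_ge0.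
  have := sqdist_polar mo al1 (ltW (lt_trans t0p ta0)) a0t ra0 (regs _ _ (ltW ta0) tte').
  have sq0 : (v2 t0 / 2 * tau) ^+ 2 <= sqdist x1 x2 a0.
    have [|x1a x2a] := ent a0; first by rewrite ta0 lexx.
    rewrite /sqdist -[leLHS]add0r lerD ?sqr_ge0 //.
    rewrite ler_sqr ?nnegrE; first by move: x2a; rewrite /a0 addrAC subrr add0r.
      by rewrite mulr_ge0 ?divr_ge0 // ltW.
    apply: le_trans x2a; rewrite mulr_ge0 ?divr_ge0 ?subr_ge0 //; exact: ltW.
  have ex : expR (- (2 * al * S)) <= expR (- (2 * al * ka) * (t - a0)).
    have kt : ka * (t - a0) <= S by rewrite mulrC -ler_pdivlMr // lerBlDl.
    rewrite ler_expR mulNr lerN2.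
    rewrite (_ : _ * (t - a0) = 2 * al * (ka * (t - a0))); last by ring.
    by rewrite ler_wpM2l //; nonneg.
  move=> sqt.
  have low : (v2 t0 / 2 * tau) ^+ 2 * expR (- (2 * al * S)) <= sqdist x1 x2 t.
    by apply: le_trans sqt; rewrite ler_pM ?expR_ge0 ?sqr_ge0.
  have eta0 : 0 <= eta by rewrite /eta; nonneg.
  apply: le_trans (ler_wpM2l eta0 low).
  rewrite LE expRN /eta le_eqVlt; apply/orP; left; apply/eqP.
  by field; rewrite !gt_eqF ?expR_gt0.
move=> t /andP[t1t tT].
have enda0 : energy ka x1 x2 v1 v2 a0 <= V ^+ 2.
  by apply: le_trans en0; apply: enle => //; exact: ltW.
case: (leP t1 te) => t1te.
  have vle : virial al ka x1 x2 v1 v2 a0 eta t1 <= virial al ka x1 x2 v1 v2 a0 eta a0.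
    apply: (virial_polar mo) => //; try exact: ltW.
    - exact/ltW/(lt_trans t0p).
    - by apply: regs => //; exact: ltW.
    - move=> u /andP[u0 u1]; apply: sqlow; try exact: ltW.
      by apply: ltW; exact: lt_le_trans t1te.
  have final := energy_of_virial al1 ka0 S0 enda0 vle.
  case: (leP t te) => tte'.
    apply: le_trans (speed t) _; apply: le_trans final.
    by apply: enle => //; exact/ltW/(lt_trans ta0).
  apply: le_trans (speed2 t) _.
  apply: (@le_trans _ _ (energy2 ka c s x1 x2 v1 v2 te)).
    by apply: en2le => //; exact: ltW.
  rewrite (en2te t) ?tte' //; apply: le_trans final.
  by apply: enle => //; exact/ltW/(lt_trans ta0).
case: exit => [teE|[ze hL reg2]].
  by exfalso; move: t1te; rewrite teE ltNge t1T.
have te0 : 0 <= te by exact/ltW/(lt_trans t0p).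
have vle1 : virial al ka x1 x2 v1 v2 a0 eta te <= virial al ka x1 x2 v1 v2 a0 eta a0.
  apply: (virial_polar mo) => //; try exact: ltW.
  - exact/ltW/(lt_trans t0p).
  - by apply: regs => //; exact: ltW.
  - move=> u /andP[u0 u1]; apply: sqlow; try exact: ltW.
    exact/ltW/(lt_trans u1).
have hz : zspeed c s v1 v2 te ^+ 2 <= eta.
  have := sqlow te (ltW ate) (lexx _) (ltW t1te).
  have -> : angmom x1 x2 v1 v2 te = angmom x1 x2 v1 v2 t0.
    by apply: (angmom_polar mo); try exact: ltW.
  rewrite -hL mulrA => hle.
  have sq : 0 < sqdist x1 x2 te.
    have := sqr_ge0 (zspeed c s v1 v2 te).
    have : 0 < angmom x1 x2 v1 v2 t0 ^+ 2 by rewrite exprn_gt0.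
    rewrite -hL => h zz.
    rewrite lt_neqAle; apply/andP; split; last by rewrite /sqdist; nonneg.
    by apply/eqP => e0; move: h; rewrite -e0 mulr0 ltxx.
  move: hle; rewrite ler_pM2r // => hle.
  have := sqr_ge0 (zspeed c s v1 v2 te); lra.
have vle2 : virial2 al ka c s x1 x2 v1 v2 a0 eta t1 <= virial2 al ka c s x1 x2 v1 v2 a0 eta te.
  apply: (virial_face2 mo) => //; try exact: ltW.
  by move=> u /andP[u0 u1]; apply: reg2; rewrite u0 (lt_le_trans u1).
have vE : virial2 al ka c s x1 x2 v1 v2 a0 eta te = virial al ka x1 x2 v1 v2 a0 eta te.
  exact: virial2E.
rewrite vE in vle2.
have final := energy2_of_virial2 al1 ka0 cs1 S0 enda0 (le_trans vle2 vle1).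
apply: le_trans (speed2 t) _; apply: le_trans final.
by apply: en2le => //; exact: ltW.
Qed.

(** * Convergence of the scalar motions *)

Lemma dist_le_speed (R : realType) (f g : R -> R) (a b B : R) :
  a <= b -> continuous f -> (forall t, a < t < b -> is_derive t 1 f (g t)) ->
  (forall t, a < t < b -> `|g t| <= B) -> `|f b - f a| <= B * (b - a).
Proof.
move=> ab cf df gB; rewrite ler_norml; apply/andP; split.
  have : f a + B * (a - a) <= f b + B * (b - a); last by lra.
  apply: (@le_of_derive_ge0 _ (fun t => f t + B * (t - a))) => //; first by cont.
  move=> t tt; have dft := df t tt.
  exists (g t + B); first by eapply der_eq; [deriv|ring].
  by have := gB t tt; rewrite ler_norml => /andP[h _]; lra.
have : f b - B * (b - a) <= f a - B * (a - a); last by lra.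
apply: (@ge_of_derive_le0 _ (fun t => f t - B * (t - a))) => //; first by cont.
move=> t tt; have dft := df t tt.
exists (g t - B); first by eapply der_eq; [deriv|ring].
by have := gB t tt; rewrite ler_norml => /andP[_ h]; lra.
Qed.

Lemma small_speed (R : realType) (a b d : R) : 0 <= d ->
  a ^+ 2 + b ^+ 2 <= d ^+ 2 -> `|a| <= d /\ `|b| <= d.
Proof.
move=> d0 h; have := sqr_ge0 a; have := sqr_ge0 b.
by split; apply: sqr_norm_le => //; lra.
Qed.

Lemma two_stage_displacement (R : realType) (x v : R -> R) (t0 t1 t V d : R) :
  t0 <= t1 -> t0 <= t -> 0 <= V -> 0 <= d -> continuous x ->
  (forall r : R, t0 < r -> is_derive r 1 x (v r)) ->
  (forall r, t0 <= r <= t -> `|v r| <= V) ->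
  (forall r, t1 <= r <= t -> `|v r| <= d) ->
  `|x t - x t0| <= V * (t1 - t0) + d * (t - t0).
Proof.
move=> t01 t0t V0 d0 cx dx vV vd.
have early u : t0 <= u -> u <= t -> `|x u - x t0| <= V * (u - t0).
  move=> t0u ut; apply: (@dist_le_speed _ x v) => // r /andP[r0 ru].
    exact: dx.
  by apply: vV; rewrite ltW //= (le_trans (ltW ru)).
have d1 : 0 <= d * (t - t0) by rewrite mulr_ge0 // subr_ge0.
have [tt1|t1t] := leP t t1.
  have h1 : V * (t - t0) <= V * (t1 - t0) by rewrite ler_wpM2l // lerD2r.
  by apply: le_trans (early t t0t (lexx _)) _; lra.
have h1 := early t1 t01 (ltW t1t).
have h2 : `|x t - x t1| <= d * (t - t1).
  apply: (@dist_le_speed _ x v) => //; first exact: ltW.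
    by move=> r /andP[r0 _]; apply: dx; exact: le_lt_trans r0.
  by move=> r /andP[r0 rt]; apply: vd; rewrite !ltW.
have h3 : d * (t - t1) <= d * (t - t0) by rewrite ler_wpM2l // lerD2l lerN2.
rewrite (_ : x t - x t0 = (x t1 - x t0) + (x t - x t1)); last by ring.
by apply: le_trans (ler_normD _ _) _; apply: lerD => //; exact: le_trans h3.
Qed.

(** The order of the choices matters: d is the speed allowed once the energy
    has decayed, S makes the energy bound O(1 / S) at most d^2 / 2, ep0 bounds
    kappa x1(t0) in terms of S, and kappa is taken large last.  The
    length tau of the ballistic stretch is sg / kappa with sg^2 proportional to
    kappa x1(t0), which balances the requirement x1 > 0 against the tangential
    speed x1(t0) / tau. *)
Lemma motion_converges (R : realType) (al c s x20 w1 w2 T e : R) :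
  1 < al -> c ^+ 2 + s ^+ 2 = 1 -> c <= 0 -> 0 < s ->
  x20 < 0 -> 0 < w1 -> 0 < w2 -> 0 <= T -> 0 < e ->
  exists2 kamin, 0 < kamin & forall ka x1 x2 v1 v2, kamin <= ka ->
    motion al ka c s x1 x2 v1 v2 -> x1 0 = 0 -> x2 0 = x20 -> v1 0 = w1 -> v2 0 = w2 ->
    forall t, 0 <= t <= T ->
    [/\ `|x1 t| <= e, t <= - x20 / w2 -> x2 t = x20 + t * w2 &
        - x20 / w2 <= t -> `|x2 t| <= e].
Proof.
move=> al1 cs1 c_le0 s_gt0 x20n w1p w2p T0 e0.
have al0 : 0 < al by exact: lt_trans al1.
set t0 := - x20 / w2.
have t0p : 0 < t0 by rewrite divr_gt0 // oppr_gt0.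
pose V := Num.sqrt (w1 ^+ 2 + w2 ^+ 2).
have V2 : V ^+ 2 = w1 ^+ 2 + w2 ^+ 2 by rewrite sqr_sqrtr //; nonneg.
have Vp : 0 < V by rewrite sqrtr_gt0 addr_gt0 // exprn_gt0.
pose d := e / (4 * (T + 1)).
have T1 : 0 < T + 1 by lra.
have dp : 0 < d by rewrite divr_gt0 // mulr_gt0.
have dT : d * T <= e / 4.
  have -> : e / 4 = d * (T + 1) by rewrite /d; field; rewrite gt_eqF.
  by rewrite ler_pM2l // lerDl.
pose cc := 1 + al + 2 * al ^+ 2.
have ccp : 0 < cc by rewrite /cc; posi.
pose S := cc * V ^+ 2 / (al * d ^+ 2).
have Sp : 0 < S by rewrite divr_gt0 // mulr_gt0 // exprn_gt0.
have Sd : cc * V ^+ 2 / (2 * al * S) = d ^+ 2 / 2.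
  by rewrite /S; field; rewrite !gt_eqF // -?V2.
pose M := (2 * al + 1) * V.
have Mp : 0 < M by rewrite /M mulr_gt0 // addr_gt0 // mulr_gt0.
pose E := expR (2 * al * S).
have Ep : 0 < E by exact: expR_gt0.
pose m1 := d ^+ 2 / (64 * M * E).
pose m2 := M / (4 * al ^+ 2).
pose m3 := w2 ^+ 2 / (2 * M).
pose ep0 := Num.min (Num.min (e / 4) m1) (Num.min m2 m3).
have ep0p : 0 < ep0.
  by rewrite /ep0 !lt_min; apply/andP; split; apply/andP; split;
    rewrite /m1 /m2 /m3; posi.
pose k1 := 4 * V * (1 + S) / e.
pose k2 := w1 ^+ 2 / (2 * al * t0 * ep0 ^+ 2).
exists (Num.max 1 (Num.max k1 k2)); first by rewrite lt_max ltr01.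
move=> ka x1 x2 v1 v2; rewrite !ge_max => /and3P[ka1 kak1 kak2].
move=> mo x10 x20E v10 v20 t /andP[t_ge0 tT].
have ka0 : 0 < ka by lra.
have [] := @face1_phase _ al ka c s x1 x2 v1 v2 t0 mo al1 ka0 x10.
- by rewrite v10.
- by rewrite x20E.
- by rewrite v20.
- by rewrite v20 x20E /t0 divfK // gt_eqF.
rewrite v10 v20 x20E => ph1 X0 q0 Xsmall.
set X := x1 t0 in X0 q0 Xsmall.
have kak1' : 4 * V * (1 + S) / ka <= e.
  by rewrite ler_pdivrMr // [e * ka]mulrC -ler_pdivrMr.
have Vka : V / ka <= e.
  apply: le_trans kak1'; rewrite ler_pM2r ?invr_gt0 //.
  have : 0 < V * S by rewrite mulr_gt0.
  lra.
have [tt0|t0t] := leP t t0.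
  have [|h1 h2 h3 h4] := ph1 t; first by rewrite t_ge0.
  have x1e : `|x1 t| <= e.
    apply: le_trans Vka; rewrite ler_pdivlMr // mulrC -{1}(gtr0_norm ka0) -normrM.
    apply: sqr_norm_le; first exact: ltW.
    by rewrite V2 exprMn; have := sqr_ge0 (v1 t); have := sqr_ge0 w2; lra.
  split=> // t0t.
  have -> : t = t0 by apply/eqP; rewrite eq_le tt0.
  have [|-> _ _ _] := ph1 t0; first by rewrite lexx ltW.
  by rewrite /t0 divfK ?gt_eqF // subrr normr0 ltW.
pose ep := ka * X.
have epp : 0 < ep by rewrite mulr_gt0.
have epep0 : ep <= ep0.
  rewrite -ler_sqr ?nnegrE ?(ltW epp) ?(ltW ep0p) // /ep exprMn.
  have h : w1 ^+ 2 <= ka * (2 * al * t0 * ep0 ^+ 2).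
    by rewrite -ler_pdivrMr //; posi.
  have pp : 0 < 2 * al * ka * t0 by posi.
  rewrite -(ler_pM2r pp); apply: le_trans Xsmall _; lra.
have [epe epm1 epm2 epm3] : [/\ ep <= e / 4, ep <= m1, ep <= m2 & ep <= m3].
  by move: epep0; rewrite /ep0 !le_min => /andP[/andP[-> ->] /andP[-> ->]].
pose sg := Num.sqrt (ep / (4 * M)).
have sgp : 0 < sg by rewrite sqrtr_gt0 divr_gt0 // mulr_gt0.
have sg2 : sg ^+ 2 = ep / (4 * M) by rewrite sqr_sqrtr // ltW // divr_gt0 // mulr_gt0.
have sgal : 4 * al * sg <= 1.
  have : (4 * al * sg) ^+ 2 <= 1 ^+ 2.
    have -> : (4 * al * sg) ^+ 2 = 16 * al ^+ 2 * sg ^+ 2 by ring.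
    have -> : 16 * al ^+ 2 * sg ^+ 2 = 4 * al ^+ 2 * ep / M.
      by rewrite sg2; field; rewrite gt_eqF.
    rewrite expr1n.
    rewrite ler_pdivrMr // mul1r.
    move: epm2; rewrite /m2 ler_pdivlMr; [lra|posi].
  by rewrite ler_sqr ?nnegrE //; nonneg.
have sgw : 2 * M * sg < w2.
  suff : (2 * M * sg) ^+ 2 < w2 ^+ 2 by rewrite ltr_sqr ?nnegrE //; nonneg.
  have -> : (2 * M * sg) ^+ 2 = 4 * M ^+ 2 * sg ^+ 2 by ring.
  have -> : 4 * M ^+ 2 * sg ^+ 2 = M * ep.
    by rewrite sg2; field; rewrite gt_eqF.
  have h : ep * (2 * M) <= w2 ^+ 2 by move: epm3; rewrite /m3 ler_pdivlMr //; posi.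
  have : 0 < M * ep by posi.
  have : 0 < w2 ^+ 2 by rewrite exprn_gt0.
  lra.
pose tau := sg / ka.
have taup : 0 < tau by rewrite divr_gt0.
have [|x2t0 v2t0 _ ent0] := ph1 t0; first by rewrite lexx ltW.
have x2t0' : x2 t0 = 0 by rewrite x2t0 /t0 divfK ?gt_eqF // subrr.
have SV : 8 * (X / tau) ^+ 2 * E + cc * V ^+ 2 / (2 * al * S) <= d ^+ 2.
  rewrite Sd (_ : (X / tau) ^+ 2 = 4 * M * ep); last first.
    have -> : (X / tau) ^+ 2 = ep ^+ 2 / sg ^+ 2.
      by rewrite /tau /ep; field; rewrite !gt_eqF.
    by rewrite sg2; field; rewrite !gt_eqF.
  have : ep * (64 * M * E) <= d ^+ 2.
    by move: epm1; rewrite /m1 ler_pdivlMr //; posi.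
  lra.
pose t1 := t0 + tau + S / ka.
have t1t0 : 0 < t1 - t0.
  by rewrite (_ : t1 - t0 = tau + S / ka); [posi|rewrite /t1; ring].
pose T' := Num.max T t1.
have [] := @motion_settles _ al ka c s x1 x2 v1 v2 t0 tau V S T'
  mo al1 ka0 cs1 c_le0 s_gt0 t0p taup x2t0' X0.
- by rewrite v2t0.
- by [].
- exact: ltW.
- rewrite v2t0 V2; lra.
- by rewrite (_ : 4 * _ = 4 * al * sg) // /tau; field; rewrite gt_eqF.
- have E1 : 2 * (ka * M * tau) = 2 * M * sg by rewrite /tau; field; rewrite gt_eqF.
  by rewrite v2t0 E1.
- have E1 : 4 * (ka * M * tau ^+ 2) = X.
    rewrite (_ : 4 * (ka * M * tau ^+ 2) = 4 * M * sg ^+ 2 / ka); last first.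
      by rewrite /tau; field; rewrite gt_eqF.
    by rewrite sg2 /ep; field; rewrite !gt_eqF.
  by rewrite E1.
- by [].
- by rewrite /T' le_max lexx orbT.
rewrite -/t1 => speedV speedd.
have tT' : t <= T' by rewrite /T' le_max tT.
have Vt1 : V * (t1 - t0) <= e / 4.
  have sg1 : sg <= 1.
    apply: le_trans sgal; rewrite ler_peMl ?(ltW sgp) //; lra.
  have -> : V * (t1 - t0) = V * (sg + S) / ka by rewrite /t1 /tau; field; rewrite gt_eqF.
  have : V * (sg + S) / ka <= V * (1 + S) / ka.
    by rewrite ler_pM2r ?invr_gt0 // ler_pM2l // lerD2r.
  lra.
have move1 (x v : R -> R) : continuous x -> (forall t : R, 0 < t -> is_derive t 1 x (v t)) ->
    (forall t D : R, 0 <= D -> v1 t ^+ 2 + v2 t ^+ 2 <= D ^+ 2 -> `|v t| <= D) ->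
    `|x t - x t0| <= e / 2.
  move=> cx dx vD.
  have t0t1 : t0 <= t1 by rewrite -subr_ge0 ltW.
  have dle : d * (t - t0) <= e / 4.
    by apply: le_trans dT; rewrite ler_pM2l // lerBlDr (le_trans tT) // lerDl ltW.
  have -> : e / 2 = e / 4 + e / 4 by field.
  apply: (@le_trans _ _ (V * (t1 - t0) + d * (t - t0))); last exact: lerD.
  apply: (@two_stage_displacement _ x v) => //; try exact: ltW.
  - by move=> r0 r0t; apply: dx; exact: lt_trans r0t.
  - move=> r0 /andP[r1 r2]; apply: vD; first exact: ltW.
    by apply: speedV; rewrite r1 (le_trans r2).
  - move=> r0 /andP[r1 r2]; apply: vD; first exact: ltW.
    by apply: le_trans SV; apply: speedd; rewrite r1 (le_trans r2).
have Xe : X <= e / 4.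
  apply: le_trans epe; rewrite /ep ler_peMl //; exact: ltW.
have e1 := move1 x1 v1 (mo_x1 mo) (mo_dx1 mo)
  (fun t D D0 h => (small_speed D0 h).1).
have e2 := move1 x2 v2 (mo_x2 mo) (mo_dx2 mo)
  (fun t D D0 h => (small_speed D0 h).2).
split.
- rewrite -[x1 t](subrK (x1 t0)); apply: le_trans (ler_normD _ _) _.
  rewrite -/X (gtr0_norm X0); rewrite -/X in e1; lra.
- by [].
- by move=> _; rewrite x2t0' subr0 in e2; lra.
Qed.

(** * Projection onto the wedge *)

Section Projections.
Context {R : realType}.
Implicit Types (x y u v p q : 'rV[R]_2) (A : set 'rV[R]_2).

Lemma dotpE x y : dotp x y = x 0 0 * y 0 0 + x 0 1 * y 0 1.
Proof.
rewrite /dotp big_ord_recl big_ord1.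
by rewrite (_ : lift ord0 ord0 = 1) //; apply: val_inj.
Qed.

Lemma row2P x y : x 0 0 = y 0 0 -> x 0 1 = y 0 1 -> x = y.
Proof.
move=> h0 h1; apply/rowP => i; case: (unliftP 0 i) => [j ->|->] //.
by rewrite ord1 (_ : lift 0 0 = 1) //; apply: val_inj.
Qed.

Lemma ptE0 (a b : R) : pt a b 0 0 = a. Proof. by rewrite mxE. Qed.
Lemma ptE1 (a b : R) : pt a b 0 1 = b. Proof. by rewrite mxE. Qed.

(** The obtuse-angle criterion: under it, |u - q|^2 exceeds |u - p|^2 by at least
    |q - p|^2. *)
Lemma nearest_proj_unique A u p : A p ->
  (forall q, A q -> dotp (u - p) (q - p) <= 0) -> nearest_proj A u = p.
Proof.
move=> Ap obtuse.
have le_enorm (a b : 'rV[R]_2) : dotp a a <= dotp b b -> enorm a <= enorm b.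
  by move=> h; rewrite /enorm ler_wsqrtr.
have dotp_ge0 (a : 'rV[R]_2) : 0 <= dotp a a.
  by rewrite dotpE -!expr2 addr_ge0 ?sqr_ge0.
have split q : dotp (u - q) (u - q) = dotp (u - p) (u - p)
    + dotp (q - p) (q - p) - 2 * dotp (u - p) (q - p).
  by rewrite !dotpE !mxE; ring.
apply: xget_unique.
  split=> // q Aq; apply: le_enorm; rewrite (split q).
  have := obtuse q Aq; have := dotp_ge0 (q - p); lra.
move=> q [Aq /(_ p Ap)]; rewrite /enorm ler_sqrt // (split q) => h.
have : dotp (q - p) (q - p) <= 0 by have := obtuse q Aq; lra.
rewrite dotpE !mxE => h0.
have := sqr_ge0 (q 0 0 - p 0 0); have := sqr_ge0 (q 0 1 - p 0 1).
move=> h1 h2; apply: row2P; apply/eqP; rewrite -subr_eq0 -sqrf_eq0 eq_le; lra.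
Qed.


Lemma orth_proj_axis2 (a b : R) :
  orth_proj [set x : 'rV[R]_2 | x 0 0 = 0] (pt a b) = pt 0 b.
Proof.
apply: xget_unique.
  split=> [|q /= q0]; first by rewrite /= ptE0.
  by rewrite dotpE !mxE /= q0; ring.
move=> q [/= q0 /(_ (pt 0 1))].
rewrite /= ptE0 => /(_ erefl); rewrite dotpE !mxE /= => h.
by apply: row2P; rewrite ?ptE0 ?ptE1 //; lra.
Qed.

Section Cone.
Variable theta : R.
Hypothesis thetaP : pi / 2 <= theta < pi.
Let c := cos theta.
Let s := sin theta.

Lemma sin_wedge_gt0 : 0 < sin theta.
Proof.
case/andP: thetaP => h1 h2; rewrite sin_gt0_pi // h2 andbT.
by apply: lt_le_trans h1; rewrite divr_gt0 // pi_gt0.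
Qed.

(** Where the hypothesis pi / 2 <= theta matters: the wedge K is not obtuse. *)
Lemma cos_wedge_le0 : cos theta <= 0.
Proof.
case/andP: thetaP => h1 h2; rewrite -cos_pihalf.
have pi0 : 0 < pi :> R by exact: pi_gt0.
by rewrite leNgt ltr_cos ?in_itv /= -?leNgt //; lra.
Qed.

Let s0 : 0 < s. Proof. exact: sin_wedge_gt0. Qed.
Let c0 : c <= 0. Proof. exact: cos_wedge_le0. Qed.
Let cs1 : c ^+ 2 + s ^+ 2 = 1. Proof. exact: cos2Dsin2. Qed.

Lemma nearest_face1 u : 0 < u 0 0 -> u 0 1 < 0 ->
  nearest_proj (coneK theta) u = pt 0 (u 0 1).
Proof.
move=> u0 u1; apply: nearest_proj_unique.
  split; rewrite ptE0 // ptE1 mul0r add0r.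
  by apply: mulr_le0_ge0; exact: ltW.
move=> q [/= q0 q1]; rewrite dotpE !mxE /= subrr mul0r addr0 !subr0.
by rewrite pmulr_rle0.
Qed.

(** In the polar cone u is a nonnegative combination of the two outer normals. *)
Lemma nearest_polar u : 0 < u 0 1 -> c * u 0 1 < s * u 0 0 ->
  nearest_proj (coneK theta) u = 0.
Proof.
move=> u1 uz; apply: nearest_proj_unique.
  by rewrite /coneK /= !mxE !mul0r addr0.
move=> q [/= q0 q1]; rewrite dotpE !mxE !subr0.
have := cos2Dsin2 theta; rewrite -/c -/s in q1 *.
(* u is (s u_1 - c u_2) / s times e_1 plus u_2 / s times n *)
have -> : u 0 0 * q 0 0 + u 0 1 * q 0 1 =
  ((s * u 0 0 - c * u 0 1) * q 0 0 + u 0 1 * (q 0 0 * c + q 0 1 * s)) / s.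
  by field; rewrite gt_eqF.
move=> _; rewrite pmulr_lle0 ?invr_gt0 //.
have h1 : (s * u 0 0 - c * u 0 1) * q 0 0 <= 0 by rewrite pmulr_rle0 // subr_gt0.
have h2 : u 0 1 * (q 0 0 * c + q 0 1 * s) <= 0 by rewrite pmulr_rle0.
lra.
Qed.

Lemma nearest_face2 u : s * u 0 0 < c * u 0 1 -> 0 < c * u 0 0 + s * u 0 1 ->
  nearest_proj (coneK theta) u =
  u - (c * u 0 0 + s * u 0 1) *: pt c s.
Proof.
move=> uz uy; set y := c * u 0 0 + s * u 0 1.
have e0 : u 0 0 - y * c = - s * (c * u 0 1 - s * u 0 0).
  by rewrite -[X in X - _]mulr1 -cs1 /y; ring.
have e1 : u 0 1 - y * s = c * (c * u 0 1 - s * u 0 0).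
  by rewrite -[X in X - _]mulr1 -cs1 /y; ring.
apply: nearest_proj_unique.
  rewrite /coneK /= !mxE /= -/c -/s e0 e1; split.
    by rewrite mulNr oppr_le0; apply: mulr_ge0; [exact: ltW|rewrite subr_ge0 ltW].
  by rewrite le_eqVlt; apply/orP; left; apply/eqP; ring.
move=> q [/= q0]; rewrite -/c -/s => q1.
have pn : (u 0 0 - y * c) * c + (u 0 1 - y * s) * s = 0 by rewrite e0 e1; ring.
rewrite dotpE !mxE /= [leLHS](_ : _ = y * (q 0 0 * c + q 0 1 * s)
  - y * ((u 0 0 - y * c) * c + (u 0 1 - y * s) * s)); last by ring.
by rewrite pn mulr0 subr0 pmulr_rle0.
Qed.

Lemma damp_face1 u v : 0 < u 0 0 -> u 0 1 < 0 ->
  dampG (coneK theta) u v = pt (v 0 0) 0.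
Proof.
move=> u0 u1; rewrite /dampG nearest_face1 // ifF; last first.
  by apply/negP; rewrite inE => -[]; rewrite leNgt u0.
rewrite /= /enorm sqr_sqrtr; last by rewrite dotpE -!expr2 addr_ge0 ?sqr_ge0.
apply: row2P; rewrite !dotpE !mxE /= ?ptE0 ?ptE1.
  by rewrite !subrr !subr0 !mulr0 !addr0; field; rewrite gt_eqF.
by rewrite !subrr mulr0.
Qed.

Lemma notin_cone_polar u : 0 < u 0 1 -> c * u 0 1 < s * u 0 0 -> u \notin coneK theta.
Proof.
move=> u1 uz; apply/negP; rewrite inE => -[h0]; rewrite -/c -/s => h1.
have := mulr_ge0_le0 (ltW s0) h0.
have := mulr_le0 c0 h0.
have : 0 < s * u 0 1 by rewrite mulr_gt0.
lra.
Qed.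

Lemma damp_polar u v : 0 < u 0 1 -> c * u 0 1 < s * u 0 0 ->
  dampG (coneK theta) u v = (dotp v u / dotp u u) *: u.
Proof.
move=> u0 u1; rewrite /dampG nearest_polar // ifF; last first.
  by apply/negbTE/notin_cone_polar.
by rewrite /= subr0 /enorm sqr_sqrtr // dotpE -!expr2 addr_ge0 ?sqr_ge0.
Qed.

Lemma damp_face2 u v : s * u 0 0 < c * u 0 1 -> 0 < c * u 0 0 + s * u 0 1 ->
  dampG (coneK theta) u v = (c * v 0 0 + s * v 0 1) *: pt c s.
Proof.
move=> uz uy; rewrite /dampG nearest_face2 // ifF; last first.
  apply/negP; rewrite inE => -[_]; rewrite -/c -/s => h; lra.
rewrite /= (_ : u - _ = (c * u 0 0 + s * u 0 1) *: pt c s); last by rewrite opprB addrC subrK.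
set y := c * u 0 0 + s * u 0 1 in uy *.
rewrite /enorm sqr_sqrtr; last by rewrite dotpE -!expr2 addr_ge0 ?sqr_ge0.
have -> : dotp (y *: pt c s) (y *: pt c s) = y ^+ 2.
  by rewrite dotpE !mxE /= -[RHS]mulr1 -cs1; ring.
rewrite scalerA dotpE !mxE /=; congr (_ *: _); field; rewrite gt_eqF //.
Qed.

End Cone.

End Projections.

(** * Coordinates of a solution on the half-line *)

Section Clamping.
Context {R : realType}.

(** Freezing a coordinate on the negative half-line turns continuity on
    [0, +oo[ into continuity on the whole line. *)
Definition clamped (f : R -> 'rV[R]_2) (i : 'I_2) (t : R) : R := f (Num.max 0 t) 0 i.

Lemma row_coord_le (x : 'rV[R]_2) (i : 'I_2) : `|x 0 i| <= `|x|.
Proof.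
rewrite [in leRHS]/Num.Def.normr/= mx_normrE.
exact: (le_bigmax _ (fun ij : 'I_1 * 'I_2 => `|x ij.1 ij.2|) (0, i)).
Qed.

Lemma clampedE (f : R -> 'rV[R]_2) (i : 'I_2) (t : R) : 0 <= t ->
  clamped f i t = f t 0 i.
Proof. by move=> t0; rewrite /clamped max_r. Qed.

Lemma near_clampedE (f : R -> 'rV[R]_2) (i : 'I_2) (t : R) : 0 < t ->
  \forall s \near t, f s 0 i = clamped f i s.
Proof.
move=> t0; near=> s; rewrite clampedE //.
by apply: ltW; near: s; exact: lt_nbhsr.
Unshelve. all: by end_near. Qed.

Lemma clamped_continuous (f : R -> 'rV[R]_2) (i : 'I_2) :
  {within `[0, +oo[, continuous f} -> continuous (clamped f i).
Proof.
move=> /subspace_continuousP cf t.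
have m0 : 0 <= Num.max 0 t by rewrite le_max lexx.
apply/cvgrPdist_lt => e e0.
have /cvgrPdist_lt /(_ _ e0) :
    f x @[x --> within `[0, +oo[ (nbhs (Num.max 0 t))] --> f (Num.max 0 t).
  by apply: cf; rewrite /= in_itv /= m0.
rewrite near_withinE => /nbhs_ballP[d /= d0 hd].
apply/nbhs_ballP; exists d => //= y yt.
rewrite /clamped.
have y0 : 0 <= Num.max 0 y by rewrite le_max lexx.
have := hd (Num.max 0 y); rewrite in_itv /= y0 => /(_ _ isT) H.
have {}H := H _.
apply: le_lt_trans (H _).
  have := row_coord_le (f (Num.max 0 t) - f (Num.max 0 y)) i.
  by rewrite !mxE.
move: yt; rewrite /ball /=; apply: le_lt_trans.
rewrite /Num.max; case: ifP => h1; case: ifP => h2.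
- by [].
- rewrite ger0_norm; last by lra.
  apply: le_trans (ler_norm _); lra.
- rewrite ler0_norm; last by lra.
  rewrite -normrN; apply: le_trans (ler_norm _); lra.
- by rewrite subrr normr0.
Qed.

Lemma is_derive_coord (f : R -> 'rV[R]_2) (l : 'rV[R]_2) (i : 'I_2) (t : R) :
  is_derive t 1 f l -> is_derive t 1 (fun s => f s 0 i) (l 0 i).
Proof.
move=> [df <-]; apply: DeriveDef; first by move/derivable_mxP : df; exact.
by rewrite derive_mx // mxE.
Qed.

Lemma is_derive_clamped (f : R -> 'rV[R]_2) (l : 'rV[R]_2) (i : 'I_2) (t : R) :
  0 < t -> is_derive t 1 f l -> is_derive t 1 (clamped f i) (l 0 i).
Proof.
move=> t0 df; apply: near_eq_is_derive (is_derive_coord i df).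
exact: near_clampedE.
Qed.

Lemma abs_continuous_clamped (f : R -> 'rV[R]_2) (i : 'I_2) (T : R) :
  abs_continuous 0 T f -> abs_continuous 0 T (clamped f i).
Proof.
move=> acf e /acf[d d0 H]; exists d => // s s1 s2 s3.
apply: le_lt_trans (H s s1 s2 s3).
rewrite big_seq [leRHS]big_seq; apply: ler_sum => I /(allP s1) /and3P[i1 i2 _].
rewrite !clampedE ?(le_trans i1) //.
by have := row_coord_le (f I.2 - f I.1) i; rewrite !mxE.
Qed.

(** At 0 continuity comes from the bounded one-sided difference quotient. *)
Lemma C1_halfline_continuous (u v : R -> 'rV[R]_2) :
  C1_halfline u v -> {within `[0, +oo[, continuous u}.
Proof.
move=> [du dr _]; apply/subspace_continuousP => t; rewrite /= in_itv /= andbT.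
rewrite le_eqVlt => /predU1P[<-|t0]; last first.
  apply: cvg_within_filter; apply: differentiable_continuous.
  by apply/derivable1_diffP; have := du t t0 => /@ex_derive.
apply/cvgrPdist_lt => e e0.
pose B := `|v 0| + 1.
have B0 : 0 < B by rewrite /B ltr_wpDl.
have one : (0 : R) < 1 by [].
move/cvgrPdist_lt : dr => /(_ _ one); rewrite near_withinE => /nbhs_ballP[d /= d0 hd].
apply/nbhs_ballP; exists (Num.min d (e / B)) => /=.
  by rewrite lt_min d0 divr_gt0.
move=> y; rewrite /ball /= sub0r normrN lt_min => /andP[yd ye].
rewrite in_itv /= andbT le_eqVlt => /predU1P[<-|y0]; first by rewrite subrr normr0.
have := hd y; rewrite /ball /= sub0r normrN => /(_ yd y0) h.
have hB : `|y^-1 *: (u y - u 0)| < B.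
  rewrite -[_ *: _](subKr (v 0)); apply: le_lt_trans (ler_normB _ _) _.
  by rewrite ltrD2l.
move: hB; rewrite normrZ normfV gtr0_norm // ltr_pdivrMl // => hB.
rewrite -normrN opprB; apply: lt_le_trans hB _.
by move: ye; rewrite gtr0_norm // ltr_pdivlMr // => /ltW.
Qed.

End Clamping.

(** * The penalized solutions *)

Lemma near_gt0 (R : realType) (f : R -> R) (t : R) :
  continuous f -> 0 < f t -> \forall s \near t, 0 < f s.
Proof.
move=> cf ft; have /cvgrPdist_lt /(_ _ ft) := cf t.
rewrite near_simpl; apply: filterS => s; rewrite ltr_norml => /andP[_]; lra.
Qed.

Section PenalizedMotion.
Context {R : realType} (theta al k : R) (u v : R -> 'rV[R]_2).
Hypothesis thetaP : pi / 2 <= theta < pi.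
Hypothesis k0 : 0 < k.
Hypothesis uv : C1_halfline u v.
Hypothesis acv : forall T, 0 < T -> abs_continuous 0 T v.
Hypothesis eqn : {ae @lebesgue_measure R, forall t : R, 0 < t ->
  derivable v t 1 /\
  'D_1 v t + (2 * al * Num.sqrt k) *: dampG (coneK theta) (u t) (v t)
    + k *: (u t - nearest_proj (coneK theta) (u t)) = 0}.

Let ka := Num.sqrt k.
Let c := cos theta.
Let s := sin theta.
Let x1 := clamped u 0.
Let x2 := clamped u 1.
Let v1 := clamped v 0.
Let v2 := clamped v 1.

Let k2 : ka ^+ 2 = k. Proof. by rewrite /ka sqr_sqrtr // ltW. Qed.
Let cx i : continuous (clamped u i).
Proof. exact/clamped_continuous/(C1_halfline_continuous uv). Qed.
Let cv i : continuous (clamped v i).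
Proof. by apply: clamped_continuous; case: uv. Qed.
Let cx1 : continuous x1. Proof. exact: cx. Qed.
Let cx2 : continuous x2. Proof. exact: cx. Qed.
Let cv1 : continuous v1. Proof. exact: cv. Qed.
Let cv2 : continuous v2. Proof. exact: cv. Qed.

Definition force (t : R) : 'rV[R]_2 :=
  - ((2 * al * ka) *: dampG (coneK theta) (u t) (v t)
     + k *: (u t - nearest_proj (coneK theta) (u t))).

(** The equation holds almost everywhere, with the reaction computed by [force];
    on a neighbourhood where [force] has a continuous expression it holds
    everywhere. *)
Lemma is_derive_velocity (F : R -> R) (i : 'I_2) (t : R) : 0 < t ->
  (\forall r \near t, 0 < r -> force r 0 i = F r) -> {for t, continuous F} ->
  is_derive t 1 (clamped v i) (F t).
Proof.
move=> t0 nF cF.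
apply: (@abs_continuous_is_derive _ _ F (fun r => force r 0 i)) => //.
- by move=> T T0; apply: abs_continuous_clamped; exact: acv.
- apply: ae_lebesgueS eqn => r + r0 => /(_ r0)[dv E].
  have : is_derive r 1 (clamped v i) ('D_1 v r 0 i).
    by apply: is_derive_clamped => //; exact: DeriveDef.
  move=> [dvi ->]; split=> //; congr (fun_of_matrix _ _ _).
  by apply/eqP; rewrite /force -addr_eq0 addrA E.
- near=> r; have r0 : 0 < r by near: r; exact: lt_nbhsr.
  move: r0; near: r; exact: nF.
Unshelve. all: by end_near. Qed.

Lemma penalized_motion : motion al ka c s x1 x2 v1 v2.
Proof.
have cfor (F : R -> R) (t : R) : continuous F -> {for t, continuous F} by move=> h; exact: h.
split=> // [t t0|t t0|t t0 x1p x2n|t t0 x2p zn|t t0 zp yp a].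
- rewrite /v1 clampedE ?(ltW t0) //; apply: is_derive_clamped => //.
  by case: uv => h _ _; exact: h.
- rewrite /v2 clampedE ?(ltW t0) //; apply: is_derive_clamped => //.
  by case: uv => h _ _; exact: h.
- have n1 := near_gt0 cx1 x1p.
  have n2 : \forall r \near t, 0 < - x2 r.
    by apply: (@near_gt0 _ (fun r => - x2 r)); [cont|rewrite oppr_gt0].
  have reg r : 0 < r -> 0 < x1 r -> 0 < - x2 r ->
      force r = - ((2 * al * ka) *: pt (v r 0 0) 0 + k *: (u r - pt 0 (u r 0 1))).
    move=> r0; rewrite oppr_gt0 /x1 /x2 !clampedE ?(ltW r0) // => h1 h2.
    by rewrite /force damp_face1 // nearest_face1.
  split.
    apply: (is_derive_velocity (F := fun t => - (2 * al * ka * v1 t + ka ^+ 2 * x1 t))) => //.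
      near=> r => r0; rewrite reg //; [|by near: r..].
      by rewrite !mxE /= k2 /v1 /x1 !clampedE ?(ltW r0) // subr0.
    by apply: cfor; cont.
  apply: (is_derive_velocity (F := fun=> 0)) => //.
    near=> r => r0; rewrite reg //; [|by near: r..].
    by rewrite !mxE /= subrr !mulr0 addr0 oppr0.
  by apply: cfor; cont.
- have n1 := near_gt0 cx2 x2p.
  have n2 : \forall r \near t, 0 < s * x1 r - c * x2 r.
    by apply: (@near_gt0 _ (fun r => s * x1 r - c * x2 r)); [cont|rewrite subr_gt0].
  pose D r := (x1 r * v1 r + x2 r * v2 r) * (x1 r ^+ 2 + x2 r ^+ 2)^-1.
  have reg r i : 0 < r -> 0 < x2 r -> 0 < s * x1 r - c * x2 r ->
      force r 0 i = - (2 * al * ka * D r + ka ^+ 2) * clamped u i r.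
    move=> r0; rewrite subr_gt0 /x1 /x2 !clampedE ?(ltW r0) // => h1 h2.
    rewrite /force damp_polar // nearest_polar // subr0 !mxE !dotpE k2.
    rewrite /D /x1 /x2 /v1 /v2 !clampedE ?(ltW r0) // !expr2.
    by rewrite [v r 0 0 * _]mulrC [v r 0 1 * _]mulrC; ring.
  have sq0 : 0 < x1 t ^+ 2 + x2 t ^+ 2.
    by rewrite ltr_wpDl ?sqr_ge0 // exprn_gt0.
  have cD : {for t, continuous D}.
    apply: continuousM; first by apply: cfor; cont.
    apply: continuousV; first by rewrite gt_eqF.
    by apply: (cfor (fun r => x1 r ^+ 2 + x2 r ^+ 2)); cont.
  have dv i : is_derive t 1 (clamped v i) (- (2 * al * ka * D t + ka ^+ 2) * clamped u i t).
    apply: (is_derive_velocity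
      (F := fun r => - (2 * al * ka * D r + ka ^+ 2) * clamped u i r)) => //.
      by near=> r => r0; rewrite reg //; near: r.
    apply: continuousM; last exact: cfor.
    apply: continuousN; apply: continuousD; last by apply: cfor; cont.
    by apply: continuousM => //; apply: cfor; cont.
  exists (D t); split; [by rewrite /D divfK // gt_eqF|exact: dv|exact: dv].
- have n1 : \forall r \near t, 0 < c * x2 r - s * x1 r.
    by apply: (@near_gt0 _ (fun r => c * x2 r - s * x1 r)); [cont|rewrite subr_gt0].
  have n2 : \forall r \near t, 0 < c * x1 r + s * x2 r.
    by apply: (@near_gt0 _ (fun r => c * x1 r + s * x2 r)) => //; cont.
  pose A r := - (2 * al * ka * (c * v1 r + s * v2 r)
                + ka ^+ 2 * (c * x1 r + s * x2 r)).
  have cA : continuous A by rewrite /A; cont.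
  have reg r i : 0 < r -> 0 < c * x2 r - s * x1 r -> 0 < c * x1 r + s * x2 r ->
      force r 0 i = A r * pt c s 0 i.
    move=> r0; rewrite subr_gt0 /x1 /x2 !clampedE ?(ltW r0) // => h1 h2.
    rewrite /force damp_face2 // nearest_face2 // /A k2.
    rewrite /x1 /x2 /v1 /v2 !clampedE ?(ltW r0) //.
    by rewrite !mxE -/c -/s; ring.
  have dv i : is_derive t 1 (clamped v i) (A t * pt c s 0 i).
    apply: (is_derive_velocity (F := fun r => A r * pt c s 0 i)) => //.
      by near=> r => r0; rewrite reg //; near: r.
    by apply: cfor; cont.
  have h0 := dv 0; have h1 := dv 1.
  by rewrite ptE0 in h0; rewrite ptE1 in h1.
Unshelve. all: by end_near. Qed.

End PenalizedMotion.

Lemma row2_norm_le (R : realType) (x : 'rV[R]_2) (e : R) : 0 <= e ->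
  `|x 0 0| <= e -> `|x 0 1| <= e -> `|x| <= e.
Proof.
move=> e0 h0 h1; rewrite /Num.Def.normr/= mx_normrE.
apply: bigmax_le => // -[i j] _ /=; rewrite ord1.
case: (unliftP 0 j) => [j' ->|->] //.
by rewrite ord1 (_ : lift 0 0 = 1) //; apply: val_inj.
Qed.

Unset Implicit Arguments.

Theorem theorem7p2 (R : realType) (theta alpha x2 dx1 dx2 : R)
    (u : R -> R -> 'rV[R]_2)
    (htheta : pi / 2 <= theta < pi) (halpha : 1 < alpha)
    (hx2 : x2 < 0) (hdx1 : 0 < dx1) (hdx2 : 0 < dx2)
    (hu : forall k : R, 0 < k ->
       penalized_solution theta alpha k (pt 0 x2) (pt dx1 dx2) (u k)) :
  {family (fun A : set R => compact A /\ A `<=` `[0, +oo[),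
    u k @[k --> +oo] --> u_infty (pt 0 x2) (pt dx1 dx2) (- x2 / dx2)}.
Proof.
apply/fam_cvgP => A [cA A0].
have [T T0 AT] : exists2 T : R, 0 <= T & forall t, A t -> 0 <= t <= T.
  have [M [Mreal HM]] := compact_bounded cA.
  exists (Num.max 0 (M + 1)); first by rewrite le_max lexx.
  move=> t At; have /= := A0 t At; rewrite in_itv /= andbT => -> /=.
  rewrite le_max; apply/orP; right.
  apply: le_trans (ler_norm _) _.
  by apply: (HM (M + 1)) => //; rewrite ltrDl.
move=> P /uniform_nbhs[E [entE EP]].
move: entE; rewrite /= -entourage_from_ballE => -[e /= e0 eE].
have e2 : 0 < e / 2 by rewrite divr_gt0.
have [kamin kamin0 H] := motion_converges halpha (cos2Dsin2 theta)
  (cos_wedge_le0 htheta) (sin_wedge_gt0 htheta) hx2 hdx1 hdx2 T0 e2.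
have : \forall k \near +oo, kamin ^+ 2 < k by apply: nbhs_pinfty_gt; exact: num_real.
apply: filterS => k hk; apply: EP => t At; apply: eE.
have k0 : 0 < k by apply: lt_trans hk; rewrite exprn_gt0.
have [v [C1 [u0 v0] acv eqn]] := hu k k0.
have mo := penalized_motion htheta k0 C1 acv eqn.
have kak : kamin <= Num.sqrt k.
  by rewrite -[kamin]ger0_norm ?(ltW kamin0) // -sqrtr_sqr ler_sqrt // ltW.
have /andP[t_ge0 tT] := AT t At.
have [h1 h2 h3] : [/\ `|clamped (u k) 0 t| <= e / 2,
    t <= - x2 / dx2 -> clamped (u k) 1 t = x2 + t * dx2 &
    - x2 / dx2 <= t -> `|clamped (u k) 1 t| <= e / 2].
  apply: (H _ _ _ _ _ kak mo); rewrite ?clampedE ?u0 ?v0 ?ptE0 ?ptE1 //.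
  exact: AT.
rewrite !clampedE // in h1 h2 h3.
rewrite -ball_normE /ball_ /= distrC.
apply: (@le_lt_trans _ _ (e / 2)); last by lra.
rewrite /u_infty orth_proj_axis2; case: ifPn => tt.
  apply: row2_norm_le; rewrite ?(ltW e2) // !mxE /=.
    by rewrite mulr0 addr0 subr0.
  by rewrite h2 // subrr normr0 ltW.
apply: row2_norm_le; rewrite ?(ltW e2) // !mxE /= subr0 //.
by apply: h3; rewrite ltW // ltNge.
Qed.
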